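(* There exists a polynomial-time $O(1)$-approximation algorithm for the parity-constrained $k$-center problem.
   Context: In the parity-constrained $k$-center problem, the input is a finite set of nodes $V$, a metric $c$ on $V$, an integer $k$, and parity constraints $\pi:V\to\{\mathsf{odd},\mathsf{even},\mathsf{unconstrained}\}$. A feasible solution is a set $S\subseteq V$ with $|S|\le k$ and an assignment $\sigma:V\to S$ such that for every $u\in S$, $|\sigma^{-1}(u)|$ is odd if $\pi(u)=\mathsf{odd}$ and even if $\pi(u)=\mathsf{even}$ (no condition if $\pi(u)=\mathsf{unconstrained}$). The objective is to minimize $\max_{v\in V}c(\sigma(v),v)$. An $\alpha$-approximation algorithm is a polynomial-time algorithm that, on every instance admitting a feasible solution, outputs a feasible solution whose objective value is at most $\alpha$ times the optimum; an $O(1)$-approximation algorithm is an $\alpha$-approximation algorithm for some constant $\alpha$. *)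

(* Defs.v *)
From mathcomp Require Import all_boot all_order all_algebra.

Set Implicit Arguments.
Unset Strict Implicit.
Unset Printing Implicit Defensive.

Import Order.TTheory GRing.Theory Num.Theory.

(******************************************************************************)
(* Model of computation: while-programs on a random access machine with       *)
(* unbounded natural-number registers and memory cells, under the logarithmic *)
(* cost criterion (Cook-Reckhow; Aho-Hopcroft-Ullman, including their MULT    *)
(* and DIV instructions).  Every evaluated (sub)expression is charged the     *)
(* number of bits of its value, and addresses are themselves expressions, so  *)
(* running time is polynomially related to Turing machine time.               *)
(******************************************************************************)

(* The number 0 is charged one bit. *)
Definition bitlen (m : nat) : nat := (trunc_log 2 m).+1.

Definition bitsize (s : seq nat) : nat := \sum_(m <- s) bitlen m.

(* OpSub is truncated, OpDiv is Euclidean with m %/ 0 = 0. *)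
Inductive binop := OpAdd | OpSub | OpMul | OpDiv.

Definition eval_op (o : binop) : nat -> nat -> nat :=
  match o with OpAdd => addn | OpSub => subn | OpMul => muln | OpDiv => divn end.

Inductive expr :=
| Const of nat
| Reg of nat
| Fetch of expr                           (* memory cell at a given address *)
| Op of binop & expr & expr.

Inductive prog :=
| Skip
| Assign of nat & expr                    (* register := value *)
| Store of expr & expr                    (* memory[address] := value *)
| Then of prog & prog
| If of expr & prog & prog                (* nonzero means true *)
| While of expr & prog.

Record state := State { reg : nat -> nat; cell : nat -> nat }.

Definition update (f : nat -> nat) (x v : nat) : nat -> nat :=
  fun y => if y == x then v else f y.

Fixpoint eval (s : state) (e : expr) : nat :=
  match e with
  | Const m => m
  | Reg x => reg s x
  | Fetch a => cell s (eval s a)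
  | Op o e1 e2 => eval_op o (eval s e1) (eval s e2)
  end.

Fixpoint ecost (s : state) (e : expr) : nat :=
  bitlen (eval s e) +
  match e with
  | Const _ | Reg _ => 0
  | Fetch a => ecost s a
  | Op _ e1 e2 => ecost s e1 + ecost s e2
  end.

(* [exec P s t s']: started in state s, P halts in state s' after time t. *)
Inductive exec : prog -> state -> nat -> state -> Prop :=
| ExecSkip s :
    exec Skip s 1 s
| ExecAssign s x e :
    exec (Assign x e) s (ecost s e).+1
         (State (update (reg s) x (eval s e)) (cell s))
| ExecStore s a e :
    exec (Store a e) s (ecost s a + ecost s e).+1
         (State (reg s) (update (cell s) (eval s a) (eval s e)))
| ExecThen P Q s s' s'' t t' :
    exec P s t s' -> exec Q s' t' s'' -> exec (Then P Q) s (t + t') s''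
| ExecIf e P Q s s' t :
    exec (if eval s e != 0 then P else Q) s t s' ->
    exec (If e P Q) s (ecost s e + t).+1 s'
| ExecWhileStop e P s :
    eval s e = 0 -> exec (While e P) s (ecost s e).+1 s
| ExecWhileStep e P s s' s'' t t' :
    eval s e <> 0 -> exec P s t s' -> exec (While e P) s' t' s'' ->
    exec (While e P) s (ecost s e + t + t').+1 s''.

(* Input and output convention: a sequence occupies the memory cells 0, 1, ... *)
(* and its length is in register 0; all the rest is initially 0.              *)
Definition init_state (inp : seq nat) : state :=
  State (fun x => if x == 0 then size inp else 0) (nth 0 inp).

Definition output (s : state) : seq nat := mkseq (cell s) (reg s 0).

Definition runs (P : prog) (inp : seq nat) (t : nat) (out : seq nat) : Prop :=
  exists2 s, exec P (init_state inp) t s & output s = out.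

(******************************************************************************)
(* Parity-constrained k-center                                                *)
(******************************************************************************)

Inductive parity := Odd | Even | Unconstrained.

Local Open Scope ring_scope.

Definition is_metric (T : Type) (c : T -> T -> rat) : Prop :=
  [/\ forall u v, 0 <= c u v,
      forall u v, c u v = 0 <-> u = v,
      forall u v, c u v = c v u
    & forall u v w, c u w <= c u v + c v w].

(* The nodes are 0, ..., n - 1.  Distances are rational so that an instance   *)
(* is a finite object that can be given to a machine.                         *)
Record instance := Instance {
  num_nodes : nat;
  dist : 'I_num_nodes -> 'I_num_nodes -> rat;
  dist_metric : is_metric dist;
  max_centers : nat;
  constraint : 'I_num_nodes -> parity
}.

Record solution (I : instance) := Solution {
  centers : {set 'I_(num_nodes I)};
  assignment : 'I_(num_nodes I) -> 'I_(num_nodes I)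
}.

Definition parity_ok (p : parity) (m : nat) : Prop :=
  match p with
  | Odd => odd m
  | Even => ~~ odd m
  | Unconstrained => True
  end.

Definition feasible (I : instance) (s : solution I) : Prop :=
  [/\ (#|centers s| <= max_centers I)%N,
      forall v, assignment s v \in centers s
    & forall u, u \in centers s ->
        parity_ok (constraint u) #|[set v | assignment s v == u]|].

(* Distances are nonnegative, so the default 0 only matters when there is no  *)
(* node.                                                                      *)
Definition objective (I : instance) (s : solution I) : rat :=
  \big[Num.max/0]_(v : 'I_(num_nodes I)) dist (assignment s v) v.

Definition is_optimum (I : instance) (opt : rat) : Prop :=
  (exists2 s : solution I, feasible s & objective s = opt) /\
  (forall s : solution I, feasible s -> opt <= objective s).

Definition encode_parity (p : parity) : nat :=
  match p with Unconstrained => 0 | Odd => 1 | Even => 2 end%N.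

Definition encode_rat (q : rat) : seq nat := [:: `|numq q|%N; `|denq q|%N].

(* Number of nodes, k, the n constraints, then the distance matrix row by row,*)
(* each (nonnegative) entry as a reduced fraction.                            *)
Definition encode_instance (I : instance) : seq nat :=
  [:: num_nodes I; max_centers I]
  ++ [seq encode_parity (constraint v) | v <- enum 'I_(num_nodes I)]
  ++ flatten [seq encode_rat (dist u v) | u <- enum 'I_(num_nodes I),
                                          v <- enum 'I_(num_nodes I)].

(* The characteristic vector of the set of centers, then the assignment.      *)
Definition encode_solution (I : instance) (s : solution I) : seq nat :=
  [seq nat_of_bool (v \in centers s) | v <- enum 'I_(num_nodes I)]
  ++ [seq nat_of_ord (assignment s v) | v <- enum 'I_(num_nodes I)].

Definition polynomial_time (P : prog) : Prop :=
  exists p : {poly nat}, forall I : instance,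
    exists t out, runs P (encode_instance I) t out /\
                  (t <= p.[bitsize (encode_instance I)])%N.

Definition approximation_algorithm (alpha : rat) (P : prog) : Prop :=
  polynomial_time P /\
  forall I : instance, (exists s : solution I, feasible s) ->
    exists t (s : solution I),
      [/\ runs P (encode_instance I) t (encode_solution s),
          feasible s
        & forall opt, is_optimum I opt -> objective s <= alpha * opt].

(* Main.v *)
Require Import Defs.
From mathcomp Require Import all_boot all_order all_algebra.
From mathcomp Require Import zify.

Set Implicit Arguments.
Unset Strict Implicit.
Unset Printing Implicit Defensive.

(******************************************************************************)
(* Guess the optimal radius r among the n^2 distances.  Grow a forest of      *)
(* clusters greedily: the next center is an uncovered node within 3r of an    *)
(* old center if there is one, otherwise an uncovered node, unconstrained if  *)
(* possible, which starts a new tree; a new center covers radius 2r and       *)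
(* captures the nodes within r.  Every tree covers a union of components of   *)
(* the graph "distance <= r", so the optimum splits along the trees, and it   *)
(* opens at least one center per cluster.                                     *)
(*   If each cluster is assigned to one of its nodes, its representative, then*)
(* going up a tree each cluster with the wrong parity can hand the client     *)
(* that is its representative over to its parent (distance at most 7r), so    *)
(* only the parity at the root may remain wrong.  This is harmless if the     *)
(* root is unconstrained.  Otherwise the whole tree is constrained, and the   *)
(* defect is repaired by giving some cluster a representative of the other    *)
(* parity, or else by opening one more odd node as a singleton.  When no swap *)
(* is possible, counting parities shows that the optimum also opens an odd    *)
(* center in that tree besides the one serving each cluster center.           *)
(*   The program is written in a language of bounded loops with arrays, where *)
(* stored values grow only additively; compiling such a program to the random *)
(* access machine gives polynomial time by a syntactic bound.                 *)
(******************************************************************************)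

(** * Bounded-loop programs and their compilation *)

(** If there is a node at all, the optimal radius is one of the pairwise distances. So it suffices
    to test every guess r by a procedure that yields a feasible solution of radius at most 7r when
    it succeeds, and that must succeed when some feasible solution has radius at most r. The
    smallest successful guess is then at most the optimum, whence the factor 7. Both halves of the
    test are [repair_spec]; the minimum over guesses is [main_spec].

    Soundness. [pclust_extend] shows that the greedy choice preserves the cluster forest. Parity
    errors are pushed from children to parents, so after the push only a root can be wrong, and
    [balanced] excludes this when the root is constrained. The resulting map [sigma] is handled by
    [sigma_dist] and [sigma_parity].

    Completeness. The ball of radius r around a cluster center lies in its cluster, so a solution of
    radius r opens at least [m] centers, one per cluster. Trees are closed under steps of length at
    most r, so the solution splits along them. In a tree with constrained root all nodes are
    constrained, hence the number of its nodes has the parity of the number of odd centers opened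
    there. If no swap of representatives repairs a defective tree, this count forces a further odd
    center ([defect_witness]). Thus [centers_ge] bounds by k what the procedure opens.

    Running time. Stored numbers grow only by additive constants, so their bit lengths stay
    polynomial; [compile_exec] turns this into a time bound and [driver_runs] applies it to every
    input, feasible or not. *)

Inductive lexpr :=
| LConst of nat
| LSize
| LVar of nat
| LInp of lexpr
| LArr of nat & lexpr
| LOp of binop & lexpr & lexpr.

Inductive lcmd :=
| LSkip
| LSet of nat & lexpr
| LPut of nat & lexpr & lexpr
| LOut of lexpr & lexpr
| LSeq of lcmd & lcmd
| LIf of lexpr & lcmd & lcmd
| LFor of nat & lcmd.

Record lstate := LState {
  var : nat -> nat; inp : nat -> nat; arr : nat -> nat -> nat }.

Definition upd (T : Type) (f : nat -> T) (x : nat) (v : T) : nat -> T :=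
  fun y => if eqn y x then v else f y.

Definition setvar (s : lstate) x v := LState (upd (var s) x v) (inp s) (arr s).
Definition setinp (s : lstate) a v := LState (var s) (upd (inp s) a v) (arr s).
Definition setarr (s : lstate) j a v :=
  LState (var s) (inp s) (upd (arr s) j (upd (arr s j) a v)).

Section Semantics.
Variables N B : nat.

Fixpoint leval (s : lstate) (e : lexpr) : nat :=
  match e with
  | LConst m => m
  | LSize => N
  | LVar x => var s x
  | LInp a => inp s (minn (leval s a) B)
  | LArr j a => arr s j (leval s a)
  | LOp o e1 e2 => eval_op o (leval s e1) (leval s e2)
  end.

Fixpoint lrun (c : lcmd) (s : lstate) : lstate :=
  match c with
  | LSkip => s
  | LSet x e => setvar s x (leval s e)
  | LPut j a e => setarr s j (leval s a) (leval s e)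
  | LOut a e => setinp s (minn (leval s a) B) (leval s e)
  | LSeq c1 c2 => lrun c2 (lrun c1 s)
  | LIf e c1 c2 => if leval s e != 0 then lrun c1 s else lrun c2 s
  | LFor x c => iteri N (fun i s => setvar (lrun c s) x i.+1) (setvar s x 0)
  end.

End Semantics.

Fixpoint wvars (c : lcmd) : seq nat :=
  match c with
  | LSet x _ => [:: x]
  | LSeq c1 c2 | LIf _ c1 c2 => wvars c1 ++ wvars c2
  | LFor x c => x :: wvars c
  | _ => [::]
  end.

Fixpoint warrs (c : lcmd) : seq nat :=
  match c with
  | LPut j _ _ => [:: j]
  | LSeq c1 c2 | LIf _ c1 c2 => warrs c1 ++ warrs c2
  | LFor x c => warrs c
  | _ => [::]
  end.

Fixpoint winp (c : lcmd) : bool :=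
  match c with
  | LOut _ _ => true
  | LSeq c1 c2 | LIf _ c1 c2 => winp c1 || winp c2
  | LFor x c => winp c
  | _ => false
  end.

(** * What a command leaves unchanged, and the loop invariant rule *)

Section Frame.
Variables N B : nat.

Lemma frame_var c x s : x \notin wvars c -> var (lrun N B c s) x = var s x.
Proof.
elim: c s => //= [y e|c1 IH1 c2 IH2|e c1 IH1 c2 IH2|y c IH] s.
- by rewrite inE /upd eqnE; case: eqP.
- by rewrite mem_cat negb_or => /andP[h1 h2]; rewrite IH2 // IH1.
- by rewrite mem_cat negb_or => /andP[h1 h2]; case: ifP => _; rewrite ?IH2 // IH1.
- rewrite inE negb_or => /andP[/negbTE h1 h2].
  elim: {1}N => [|i IHi] /=; first by rewrite /upd eqnE h1.
  by rewrite /upd eqnE h1 IH.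
Qed.

Lemma frame_arr c j s : j \notin warrs c -> arr (lrun N B c s) j = arr s j.
Proof.
elim: c s => //= [y a e|c1 IH1 c2 IH2|e c1 IH1 c2 IH2|y c IH] s.
- by rewrite inE /upd eqnE; case: eqP.
- by rewrite mem_cat negb_or => /andP[h1 h2]; rewrite IH2 // IH1.
- by rewrite mem_cat negb_or => /andP[h1 h2]; case: ifP => _; rewrite ?IH2 // IH1.
- by move=> h; elim: {1}N => [|i IHi] //=; rewrite IH.
Qed.

Lemma frame_inp c s : ~~ winp c -> inp (lrun N B c s) = inp s.
Proof.
elim: c s => //= [c1 IH1 c2 IH2|e c1 IH1 c2 IH2|y c IH] s.
- by rewrite negb_or => /andP[h1 h2]; rewrite IH2 // IH1.
- by rewrite negb_or => /andP[h1 h2]; case: ifP => _; rewrite ?IH2 // IH1.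
- by move=> h; elim: {1}N => [|i IHi] //=; rewrite IH.
Qed.

Definition agree c s s' : Prop :=
  [/\ forall y, y \notin wvars c -> var s' y = var s y,
      forall j, j \notin warrs c -> arr s' j = arr s j
    & ~~ winp c -> inp s' = inp s].

Lemma lrun_agree c s : agree c s (lrun N B c s).
Proof. by split=> *; [apply: frame_var | apply: frame_arr | apply: frame_inp]. Qed.

(** The step may use that everything the loop does not write still has its value from before the
    loop; invariants then only need to speak of what changes. The counter must not be written by the
    body. *)
Lemma for_inv (Inv : nat -> lstate -> Prop) x c s :
  x \notin wvars c ->
  Inv 0 (setvar s x 0) ->
  (forall i s', i < N -> agree (LFor x c) s s' -> var s' x = i -> Inv i s' ->
     Inv i.+1 (setvar (lrun N B c s') x i.+1)) ->
  Inv N (lrun N B (LFor x c) s).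
Proof.
move=> xc I0 IS /=.
suff H k : k <= N ->
  let s' := iteri k (fun i s => setvar (lrun N B c s) x i.+1) (setvar s x 0) in
  [/\ Inv k s', var s' x = k & agree (LFor x c) s s'] by case: (H N (leqnn _)).
elim: k => [|k IH] hk /=.
  split; rewrite // /upd ?eqnE ?eqxx //; split=> //= y.
  by rewrite inE /upd eqnE; case: eqP.
case: (IH (ltnW hk)) => h1 h2 h3; split; [exact: IS | by rewrite /upd eqnE eqxx |].
case: h3 => fv fa fi; split=> [y hy|j hj|hi] /=.
- rewrite -(fv y hy) /upd eqnE; move: hy; rewrite inE negb_or => /andP[/negbTE -> hy].
  exact: frame_var.
- by rewrite -(fa j hj) frame_arr.
- by rewrite -(fi hi) frame_inp.
Qed.

End Frame.

(* Register 0 holds the input length B and register 1 the number of nodes N.  *)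
(* Cells 0, ..., B form the array read by [LInp]: addresses are clamped to B, *)
(* and cell B, just after the input, is 0.  The 16 work arrays are interleaved*)
(* above B, so that they need no bounds.                                      *)
Fixpoint cexpr (e : lexpr) : expr :=
  match e with
  | LConst m => Const m
  | LSize => Reg 1
  | LVar x => Reg x.+2
  | LInp a => let a' := cexpr a in
      Fetch (Op OpSub a' (Op OpSub a' (Reg 0)))
  | LArr j a =>
      Fetch (Op OpAdd (Op OpAdd (Reg 0) (Const j.+1))
                      (Op OpMul (Const 16) (cexpr a)))
  | LOp o e1 e2 => Op o (cexpr e1) (cexpr e2)
  end.

Definition cfor x (P : prog) : prog :=
  Then (Assign x (Const 0))
       (While (Op OpSub (Reg 1) (Reg x))
              (Then P (Assign x (Op OpAdd (Reg x) (Const 1))))).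

Fixpoint compile (c : lcmd) : prog :=
  match c with
  | LSkip => Skip
  | LSet x e => Assign x.+2 (cexpr e)
  | LPut j a e =>
      Store (Op OpAdd (Op OpAdd (Reg 0) (Const j.+1))
                      (Op OpMul (Const 16) (cexpr a))) (cexpr e)
  | LOut a e =>
      Store (Op OpSub (cexpr a) (Op OpSub (cexpr a) (Reg 0))) (cexpr e)
  | LSeq c1 c2 => Then (compile c1) (compile c2)
  | LIf e c1 c2 => If (cexpr e) (compile c1) (compile c2)
  | LFor x c => cfor x.+2 (compile c)
  end.

Fixpoint wfe (e : lexpr) : bool :=
  match e with
  | LInp a => wfe a
  | LArr j a => (j < 16) && wfe a
  | LOp _ e1 e2 => wfe e1 && wfe e2
  | _ => true
  end.

(* Values may only grow additively: this keeps every number of a run of      *)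
(* polynomially many steps polynomially long.                                *)
Fixpoint slow (e : lexpr) : bool :=
  match e with
  | LOp OpAdd e1 (LConst _) => slow e1
  | LOp OpSub e1 _ => slow e1
  | LOp _ _ _ => false
  | _ => true
  end.

Fixpoint egrow (e : lexpr) : nat :=
  match e with
  | LConst m => m
  | LOp OpAdd e1 (LConst m) => egrow e1 + m
  | LOp OpSub e1 _ => egrow e1
  | _ => 0
  end.

Fixpoint wfc (c : lcmd) : bool :=
  match c with
  | LSkip => true
  | LSet x e => wfe e && slow e
  | LPut j a e => [&& j < 16, wfe a, wfe e & slow e]
  | LOut a e => [&& wfe a, wfe e & slow e]
  | LSeq c1 c2 => wfc c1 && wfc c2
  | LIf e c1 c2 => [&& wfe e, wfc c1 & wfc c2]
  | LFor x c => (x \notin wvars c) && wfc c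
  end.

Fixpoint cgrow (c : lcmd) (N : nat) : nat :=
  match c with
  | LSkip => 0
  | LSet _ e | LPut _ _ e | LOut _ e => egrow e
  | LSeq c1 c2 | LIf _ c1 c2 => cgrow c1 N + cgrow c2 N
  | LFor _ c => N * cgrow c N
  end.

(** The value fits in [ewidth e] blocks of b bits when all registers and cells fit in one block.
    Widths add up under products; a constant m gets [m.+1] blocks because m is below 2 to the power
    m+1. *)
Fixpoint ewidth (e : expr) : nat :=
  match e with
  | Const m => m.+1
  | Op _ e1 e2 => ewidth e1 + ewidth e2
  | _ => 1
  end.

Fixpoint etime (e : expr) : nat :=
  ewidth e +
  match e with
  | Const _ | Reg _ => 0
  | Fetch a => etime a
  | Op _ e1 e2 => etime e1 + etime e2
  end.

(** Time in units of b. Both branches of a conditional are charged, so the bound depends on [N]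
    alone and is visibly a polynomial. *)
Fixpoint ctime (c : lcmd) (N : nat) : nat :=
  match c with
  | LSkip => 1
  | LSet x e => (etime (cexpr e)).+1
  | LPut j a e =>
      (etime (Op OpAdd (Op OpAdd (Reg 0) (Const j.+1))
                      (Op OpMul (Const 16) (cexpr a))) + etime (cexpr e)).+1
  | LOut a e =>
      (etime (Op OpSub (cexpr a) (Op OpSub (cexpr a) (Reg 0))) +
       etime (cexpr e)).+1
  | LSeq c1 c2 => ctime c1 N + ctime c2 N
  | LIf e c1 c2 => (etime (cexpr e) + (ctime c1 N + ctime c2 N)).+1
  | LFor x c => 10 + N.+1 * (20 + ctime c N)
  end.

(** * Simulation of bounded loops by the random access machine *)

Record sim (N B M : nat) (s : lstate) (t : state) : Prop := Sim {
  sim_base : reg t 0 = B;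
  sim_size : reg t 1 = N;
  sim_var : forall x, reg t x.+2 = var s x;
  sim_inp : forall a, a <= B -> cell t a = inp s a;
  sim_arr : forall j i, j < 16 -> cell t (B + j.+1 + 16 * i) = arr s j i;
  sim_reg_le : forall x, reg t x <= M;
  sim_cell_le : forall a, cell t a <= M }.

Lemma sim_weaken N B M M' s t : M <= M' -> sim N B M s t -> sim N B M' s t.
Proof.
move=> h [h1 h2 h3 h4 h5 h6 h7]; split=> // x; exact: leq_trans h.
Qed.

Lemma cexprP N B M s t e :
  sim N B M s t -> wfe e -> eval t (cexpr e) = leval N B s e.
Proof.
move=> S; elim: e => //= [|x|a IH|j a IH|o e1 IH1 e2 IH2].
- by move=> _; apply: sim_size S.
- by move=> _; apply: sim_var S _.
- move=> w; rewrite (IH w) (sim_base S) -minnE (sim_inp S) //; exact: geq_minr.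
- by case/andP=> hj w; rewrite (IH w) (sim_base S) (sim_arr S).
- by case/andP=> w1 w2; rewrite IH1 // IH2.
Qed.

Lemma slow_eval N B M s t e :
  sim N B M s t -> wfe e -> slow e -> leval N B s e <= M + egrow e.
Proof.
move=> S; elim: e => //= [m|_ _|x _ _|a _ _ _|j a _ /andP[hj _] _|o e1 IH1 e2 IH2].
- by move=> _ _; rewrite leq_addl.
- by rewrite addn0 -(sim_size S) (sim_reg_le S).
- by rewrite addn0 -(sim_var S) (sim_reg_le S).
- by rewrite addn0 -(sim_inp S) ?geq_minr // (sim_cell_le S).
- by rewrite addn0 -(sim_arr S) // (sim_cell_le S).
case/andP=> w1 w2; case: o => //.
- by case: e2 {IH2} w2 => // m _ /(IH1 w1); rewrite /= addnA leq_add2r.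
- by move/(IH1 w1); apply: leq_trans; apply: leq_subr.
Qed.

Lemma bitlen_le m w : 0 < w -> m < 2 ^ w -> bitlen m <= w.
Proof.
case: w => // w _ h; rewrite /bitlen ltnS.
case: m h => [|m] h; first by rewrite trunc_log0.
rewrite -ltnS -(@ltn_exp2l 2) //; apply: leq_ltn_trans h.
exact: trunc_logP.
Qed.

Lemma ltn_bitlen m : m < 2 ^ bitlen m.
Proof. by rewrite /bitlen trunc_log_ltn. Qed.

Lemma eval_lt t M b e :
  0 < b -> (forall x, reg t x <= M) -> (forall a, cell t a <= M) -> M < 2 ^ b ->
  eval t e < 2 ^ (ewidth e * b).
Proof.
move=> b0 hr hc hM.
have b1 w : 0 < w -> w <= w * b by move=> w0; rewrite leq_pmulr.
have w0 e' : 0 < ewidth e' by elim: e' => //= _ e1 h1 e2 h2; rewrite addn_gt0 h1.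
elim: e => /= [m|x|a _|o e1 h1 e2 h2].
- apply: (@leq_trans (2 ^ m.+1)); last by rewrite leq_exp2l // b1.
  exact: ltn_trans (ltnSn m) (ltn_expl _ _).
- by rewrite mul1n (leq_ltn_trans _ hM).
- by rewrite mul1n (leq_ltn_trans _ hM).
have le1 : 2 ^ (ewidth e1 * b) <= 2 ^ ((ewidth e1 + ewidth e2) * b).
  by rewrite leq_exp2l // leq_pmul2r // leq_addr.
case: o => /=.
(* A sum also fits in the product bound: x < p and y < q with p, q at least 2 give x + y < p q. *)
- rewrite mulnDl expnD.
  have g (e' : expr) : 2 <= 2 ^ (ewidth e' * b).
    by rewrite -{1}(expn1 2) leq_exp2l // muln_gt0 w0.
  move: (g e1) (g e2) h1 h2.
  move: (2 ^ _) (2 ^ _) (eval t e1) (eval t e2) => p q x y; nia.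
- by rewrite (leq_ltn_trans (leq_subr _ _)) // (leq_trans h1).
- by rewrite mulnDl expnD ltn_mul.
- by rewrite (leq_ltn_trans (leq_div _ _)) // (leq_trans h1).
Qed.

Lemma ecost_le t M b e :
  0 < b -> (forall x, reg t x <= M) -> (forall a, cell t a <= M) -> M < 2 ^ b ->
  ecost t e <= etime e * b.
Proof.
move=> b0 hr hc hM.
have w0 e' : 0 < ewidth e' by elim: e' => //= _ e1 h1 e2 h2; rewrite addn_gt0 h1.
have h e' : bitlen (eval t e') <= ewidth e' * b.
  by apply: bitlen_le; [rewrite muln_gt0 w0 | apply: eval_lt hM].
elim: e => /= [m|x|a IH|o e1 h1 e2 h2].
- by rewrite !addn0; apply: (h (Const m)).
- by rewrite !addn0; apply: (h (Reg x)).
- by rewrite mulnDl leq_add // (h (Fetch a)).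
- by rewrite (mulnDl _ _ b) leq_add ?(h (Op o e1 e2)) // mulnDl leq_add.
Qed.

Lemma update_le f x v M M' :
  (forall y, f y <= M) -> M <= M' -> v <= M' -> forall y, update f x v y <= M'.
Proof. by move=> h hM hv y; rewrite /update; case: ifP => // _; apply: leq_trans hM. Qed.

Lemma sim_setvar N B M M' s t x v :
  sim N B M s t -> M <= M' -> v <= M' ->
  sim N B M' (setvar s x v) (State (update (reg t) x.+2 v) (cell t)).
Proof.
case=> h1 h2 h3 h4 h5 h6 h7 hM hv; split=> //=.
- by move=> y; rewrite /update /upd eqSS eqSS h3.
- exact: update_le.
- by move=> a; apply: leq_trans hM.
Qed.

(** The bound [M] on stored values grows by at most [cgrow c N] in total, so b bits suffice for
    every stored value during the run, and each evaluation costs at most its width times b. *)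
Lemma compile_exec c : wfc c -> forall N B M b s t,
  sim N B M s t -> 0 < b -> M + cgrow c N < 2 ^ b ->
  exists T t', [/\ exec (compile c) t T t', T <= ctime c N * b
                 & sim N B (M + cgrow c N) (lrun N B c s) t'].
Proof.
elim: c => [|x e|j a e|a e|c1 IH1 c2 IH2|e c1 IH1 c2 IH2|x c IH] /= w N B M b s t S b0 hb.
- by exists 1, t; split; [constructor | rewrite mul1n | rewrite addn0].
- case/andP: w => we ws.
  have hM := leq_ltn_trans (leq_addr _ _) hb.
  exists (ecost t (cexpr e)).+1.
  eexists; split; first exact: ExecAssign.
    rewrite mulSn addnC -addn1 leq_add //.
    exact: ecost_le b0 (sim_reg_le S) (sim_cell_le S) hM.
  rewrite (cexprP S we); apply: (sim_setvar _ S); first exact: leq_addr.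
  exact: slow_eval S we ws.
- case/and4P: w => hj wa we ws.
  have hM := leq_ltn_trans (leq_addr _ _) hb.
  have hc e' := @ecost_le t M b e' b0 (sim_reg_le S) (sim_cell_le S) hM.
  set A := Op OpAdd _ _.
  exists (ecost t A + ecost t (cexpr e)).+1.
  eexists; split; first exact: ExecStore.
    change ((ecost t A + ecost t (cexpr e)).+1 <=
            (etime A + etime (cexpr e)).+1 * b).
    by rewrite mulSn -add1n leq_add // mulnDl leq_add // hc.
  have EA : eval t A = B + j.+1 + 16 * leval N B s a.
    by rewrite /A /= (cexprP S wa) (sim_base S).
  rewrite EA (cexprP S we).
  have hv := slow_eval S we ws.
  case: S => h1 h2 h3 h4 h5 h6 h7; split=> //=.
  + move=> i hi; rewrite /update; case: eqP => [E|_]; first by exfalso; lia.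
    exact: h4.
  + move=> j' i hj'; rewrite /update /upd !eqnE; case: eqP => [E|E].
      (* Array numbers are below 16, so equal addresses force the same array and the same index. *)
      have -> : j' = j by lia.
      have -> : i = leval N B s a by lia.
      by rewrite !eqxx.
    case: eqP => [Ej|_]; last exact: h5.
    case: eqP => [Ei|_]; last by rewrite Ej; apply: h5.
    by case: E; rewrite Ej Ei.
  + by move=> y; apply: leq_trans (leq_addr _ _).
  + by apply: update_le => //; apply: leq_addr.
- case/and3P: w => wa we ws.
  have hM := leq_ltn_trans (leq_addr _ _) hb.
  have hc e' := @ecost_le t M b e' b0 (sim_reg_le S) (sim_cell_le S) hM.
  set A := Op OpSub _ _.
  exists (ecost t A + ecost t (cexpr e)).+1.
  eexists; split; first exact: ExecStore.
    change ((ecost t A + ecost t (cexpr e)).+1 <=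
            (etime A + etime (cexpr e)).+1 * b).
    by rewrite mulSn -add1n leq_add // mulnDl leq_add // hc.
  have EA : eval t A = minn (leval N B s a) B.
    by rewrite /A /= (cexprP S wa) (sim_base S) minnE.
  rewrite EA (cexprP S we).
  have hv := slow_eval S we ws.
  case: S => h1 h2 h3 h4 h5 h6 h7; split=> //=.
  + by move=> i hi; rewrite /update /upd eqnE h4.
  + move=> j' i hj'; rewrite /update; case: eqP => [E|_]; last exact: h5.
    by exfalso; have := geq_minr (leval N B s a) B; lia.
  + by move=> y; apply: leq_trans (leq_addr _ _).
  + by apply: update_le => //; apply: leq_addr.
- case/andP: w => w1 w2; rewrite addnA in hb.
  have [T1 [t1 [E1 L1 S1]]] := IH1 w1 _ _ _ _ _ _ S b0 (leq_ltn_trans (leq_addr _ _) hb).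
  have [T2 [t2 [E2 L2 S2]]] := IH2 w2 _ _ _ _ _ _ S1 b0 hb.
  exists (T1 + T2), t2; split; first exact: ExecThen E1 E2.
    by rewrite mulnDl leq_add.
  by rewrite addnA.
- case/and3P: w => we w1 w2.
  have hM := leq_ltn_trans (leq_addr _ _) hb.
  have hc := @ecost_le t M b (cexpr e) b0 (sim_reg_le S) (sim_cell_le S) hM.
  case: ifP => he.
    have hb1 : M + cgrow c1 N < 2 ^ b by apply: leq_ltn_trans hb; lia.
    have [T1 [t1 [E1 L1 S1]]] := IH1 w1 _ _ _ _ _ _ S b0 hb1.
    exists (ecost t (cexpr e) + T1).+1, t1; split.
    + by apply: ExecIf; rewrite (cexprP S we) he.
    + by move: hc L1 b0; move: (ecost _ _) => X; nia.
    + by apply: sim_weaken S1; lia.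
  have hb1 : M + cgrow c2 N < 2 ^ b by apply: leq_ltn_trans hb; lia.
  have [T1 [t1 [E1 L1 S1]]] := IH2 w2 _ _ _ _ _ _ S b0 hb1.
  exists (ecost t (cexpr e) + T1).+1, t1; split.
  + by apply: ExecIf; rewrite (cexprP S we) he.
  + by move: hc L1 b0; move: (ecost _ _) => X; nia.
  + by apply: sim_weaken S1; lia.
case/andP: w => xc wc.
pose st i s0 := setvar (lrun N B c s0) x i.+1.
have NM : N <= M by rewrite -(sim_size S) (sim_reg_le S).
set W := While (Op OpSub (Reg 1) (Reg x.+2))
          (Then (compile c) (Assign x.+2 (Op OpAdd (Reg x.+2) (Const 1)))).
(* Induction on the number k of iterations left. The factor [k.+1] also pays for the final failing
   test of the loop condition. *)
suff H k : k <= N -> forall i s t, i + k = N -> var s x = i ->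
    sim N B (M + i * cgrow c N) s t ->
  exists T t', [/\ exec W t T t', T <= k.+1 * (20 + ctime c N) * b
     & sim N B (M + N * cgrow c N)
         (foldl (fun s i => st i s) s (iota i k)) t'].
  have S0 : sim N B (M + 0 * cgrow c N) (setvar s x 0)
     (State (update (reg t) x.+2 0) (cell t)).
    by rewrite mul0n addn0; apply: (sim_setvar _ S).
  have [|T [t' [E L S']]] := H N (leqnn _) 0 _ _ (add0n _) _ S0.
    by rewrite /= /upd eqnE eqxx.
  have hM := leq_ltn_trans (leq_addr _ _) hb.
  have hc := @ecost_le t M b (Const 0) b0 (sim_reg_le S) (sim_cell_le S) hM.
  exists ((ecost t (Const 0)).+1 + T), t'; split.
  + by apply: ExecThen E; apply: ExecAssign.
  + by move: hc L b0; rewrite (mulnDl 10); move: (ecost _ _) (_ * _ * b) => X Y /=; lia.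
  have iteriE n : iteri n st (setvar s x 0) =
      foldl (fun s i => st i s) (setvar s x 0) (iota 0 n).
    by elim: n => // n IHn; rewrite -[X in iota 0 X]addn1 iotaD foldl_cat -IHn.
  by rewrite -/st iteriE.
have xM i : i < N -> M + i * cgrow c N + cgrow c N <= M + N * cgrow c N by nia.
elim: k => [|k IHk] hk i {S}s {}t hik hx S; have Mi : M + i * cgrow c N < 2 ^ b.
- by apply: leq_ltn_trans hb; rewrite leq_add2l leq_mul2r; lia.
- have E0 : eval t (Op OpSub (Reg 1) (Reg x.+2)) = 0.
    by rewrite /= (sim_size S) (sim_var S) hx -hik addn0 subnn.
  have hc := @ecost_le t _ b (Op OpSub (Reg 1) (Reg x.+2)) b0 (sim_reg_le S) (sim_cell_le S) Mi.
  exists (ecost t (Op OpSub (Reg 1) (Reg x.+2))).+1, t; split.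
  + exact: ExecWhileStop.
  + by move: hc b0; move: (ecost _ _) => X /=; nia.
  + by have -> : N * cgrow c N = i * cgrow c N by congr (_ * _); lia.
- by apply: leq_ltn_trans hb; rewrite leq_add2l leq_mul2r; lia.
have hi : i < N by lia.
have E0 : eval t (Op OpSub (Reg 1) (Reg x.+2)) <> 0.
  by rewrite /= (sim_size S) (sim_var S) hx; lia.
have hc := @ecost_le t _ b (Op OpSub (Reg 1) (Reg x.+2)) b0 (sim_reg_le S) (sim_cell_le S) Mi.
have hb1 : M + i * cgrow c N + cgrow c N < 2 ^ b by apply: leq_ltn_trans (xM i hi) hb.
have [T1 [t1 [E1 L1 S1]]] := IH wc _ _ _ _ _ _ S b0 hb1.
have hx1 : var (lrun N B c s) x = i by rewrite frame_var.
have hc1 := @ecost_le t1 _ b (Op OpAdd (Reg x.+2) (Const 1)) b0 (sim_reg_le S1) (sim_cell_le S1) hb1.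
have S2 : sim N B (M + i.+1 * cgrow c N) (setvar (lrun N B c s) x i.+1)
   (State (update (reg t1) x.+2 i.+1) (cell t1)).
  by apply: (sim_setvar _ S1); [rewrite mulSn; lia | lia].
have [||T2 [t2 [E2 L2 S3]]] := IHk (ltnW hk) i.+1 _ _ _ _ S2; first by lia.
  by rewrite /= /upd eqnE eqxx.
exists (ecost t (Op OpSub (Reg 1) (Reg x.+2)) +
   (T1 + (ecost t1 (Op OpAdd (Reg x.+2) (Const 1))).+1) + T2).+1, t2; split => //.
+ apply: ExecWhileStep E0 _ E2; apply: ExecThen E1 _.
  have -> : i.+1 = eval t1 (Op OpAdd (Reg x.+2) (Const 1)).
    by rewrite /= (sim_var S1) hx1 addn1.
  exact: ExecAssign.
+ by move: hc hc1 L1 L2 b0; move: (ecost _ _) (ecost _ _) => X Y /=; nia.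
Qed.

(** * Polynomial time *)

Definition is_polynomial (f : nat -> nat) : Prop :=
  exists p : {poly nat}, forall x, f x = p.[x]%R.

Lemma polynomial_const m : is_polynomial (fun=> m).
Proof. by exists m%:P%R => x; rewrite hornerC. Qed.

Lemma polynomial_id : is_polynomial id.
Proof. by exists 'X%R => x; rewrite hornerX. Qed.

Lemma polynomial_add f g :
  is_polynomial f -> is_polynomial g -> is_polynomial (fun x => f x + g x).
Proof. by case=> p hp [q hq]; exists (p + q)%R => x; rewrite hornerD hp hq. Qed.

Lemma polynomial_mul f g :
  is_polynomial f -> is_polynomial g -> is_polynomial (fun x => f x * g x).
Proof. by case=> p hp [q hq]; exists (p * q)%R => x; rewrite hornerM hp hq. Qed.

Lemma horner_nat_le (p : {poly nat}) x y : x <= y -> (p.[x]%R <= p.[y]%R)%N.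
Proof.
move=> h; rewrite !horner_coef; apply: leq_sum => i _.
apply: leq_mul => //; elim: (nat_of_ord i) => // k IH.
by rewrite !GRing.exprS; apply: leq_mul.
Qed.

Lemma polynomial_ctime c : is_polynomial (ctime c).
Proof.
elim: c => [|x e|j a e|a e|c1 IH1 c2 IH2|e c1 IH1 c2 IH2|x c IH] /=;
  try exact: polynomial_const.
- exact: polynomial_add.
- exact (polynomial_add (polynomial_const (etime (cexpr e)).+1)
           (polynomial_add IH1 IH2)).
- apply: (polynomial_add (polynomial_const 10)).
  apply: (polynomial_mul _ (polynomial_add (polynomial_const 20) IH)).
  exact: (polynomial_add (polynomial_const 1) polynomial_id).
Qed.

Lemma polynomial_cgrow c : is_polynomial (cgrow c).
Proof.
elim: c => [|x e|j a e|a e|c1 IH1 c2 IH2|e c1 IH1 c2 IH2|x c IH] /=;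
  try exact: polynomial_const.
- exact: polynomial_add.
- exact: polynomial_add.
- exact: (polynomial_mul polynomial_id IH).
Qed.

(** Cell 0 of an encoded instance holds the number of nodes. Register 0 must keep the input length
    while the compiled code runs, so the output length is stored there only at the end. *)
Definition driver (c : lcmd) : prog :=
  Then (Assign 1 (Fetch (Const 0)))
       (Then (compile c) (Assign 0 (Op OpAdd (Reg 1) (Reg 1)))).

Definition linit (xs : seq nat) : lstate :=
  LState (fun=> 0) (nth 0 xs) (fun _ _ => 0).

Definition dtime (c : lcmd) (x : nat) : nat :=
  (20 + ctime c x) * (x + cgrow c x + 1).

Lemma polynomial_dtime c : is_polynomial (dtime c).
Proof.
apply: (polynomial_mul (polynomial_add (polynomial_const 20) (polynomial_ctime c))).
apply: (polynomial_add _ (polynomial_const 1)).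
exact: (polynomial_add polynomial_id (polynomial_cgrow c)).
Qed.

Lemma size_le_bitsize xs : size xs <= bitsize xs.
Proof.
rewrite /bitsize; elim: xs => [|x xs IH] /=; first by rewrite big_nil.
by rewrite big_cons -add1n leq_add.
Qed.

Lemma nth_lt_bitsize xs i : nth 0 xs i < 2 ^ bitsize xs.
Proof.
rewrite /bitsize; elim: xs i => [|x xs IH] [|i] /=;
  rewrite ?expn_gt0 // big_cons.
  by apply: leq_trans (ltn_bitlen x) _; rewrite leq_exp2l // leq_addr.
by apply: leq_trans (IH i) _; rewrite leq_exp2l // leq_addl.
Qed.

(** With z the bit size of the input, 2 to the power z bounds the input length and every input
    number, so [z + cgrow c N + 1] bits are enough for the whole run. *)
Lemma driver_runs c xs (N := nth 0 xs 0) (B := size xs) :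
  wfc c -> N + N <= B ->
  exists2 T, runs (driver c) xs T (mkseq (inp (lrun N B c (linit xs))) (N + N))
           & T <= dtime c (bitsize xs).
Proof.
move=> wc NB; set z := bitsize xs.
have zB : B <= z by apply: size_le_bitsize.
have Nz : N <= z by lia.
pose M := 2 ^ z; pose t0 := init_state xs.
pose t1 := State (update (reg t0) 1 N) (cell t0).
have hz : z < 2 ^ z by apply: ltn_expl.
have S1 : sim N B M (linit xs) t1.
  split=> //=.
  - by move=> j i _; rewrite nth_default // -/B; lia.
  - move=> [|[|x]]; rewrite /update /=; [|by rewrite /M; lia..].
    by rewrite -/B /M; lia.
  - by move=> a; rewrite /M ltnW // nth_lt_bitsize.
have b0 : 0 < z + cgrow c N + 1 by rewrite addn1.
have hM : M + cgrow c N < 2 ^ (z + cgrow c N + 1).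
  rewrite addn1 expnS mulSn mul1n expnD -/M.
  have := ltn_expl (cgrow c N) (isT : 1 < 2); have : 0 < M by rewrite expn_gt0.
  have aux X Y g : 0 < Y -> g < X -> Y + g < Y * X + Y * X by nia.
  exact: aux.
have [T [t2 [E L S2]]] := compile_exec wc S1 b0 hM.
have M0 : M < 2 ^ (z + cgrow c N + 1) by apply: leq_ltn_trans (leq_addr _ _) hM.
have c1 : ecost t0 (Fetch (Const 0)) <= etime (Fetch (Const 0)) * (z + cgrow c N + 1).
  apply: ecost_le b0 _ _ M0 => [[|x]|a] //=; rewrite /M ?(ltnW (nth_lt_bitsize _ _)) //.
  by rewrite -/B; lia.
have c2 := @ecost_le t2 _ _ (Op OpAdd (Reg 1) (Reg 1)) b0 (sim_reg_le S2) (sim_cell_le S2) hM.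
exists ((ecost t0 (Fetch (Const 0))).+1 +
        (T + (ecost t2 (Op OpAdd (Reg 1) (Reg 1))).+1)).
  eexists.
    apply: ExecThen; first exact: ExecAssign.
    by apply: ExecThen E _; exact: ExecAssign.
  rewrite /output /= /update eqxx (sim_size S2).
  apply: (@eq_from_nth _ 0); rewrite !size_mkseq // => i hi.
  by rewrite !nth_mkseq // (sim_inp S2) //; lia.
have [p hp] := polynomial_ctime c; have [q hq] := polynomial_cgrow c.
have l1 : ctime c N <= ctime c z by rewrite !hp horner_nat_le.
have l2 : cgrow c N <= cgrow c z by rewrite !hq horner_nat_le.
move: c1 c2 L; rewrite /dtime /etime /ewidth.
move: (ecost _ _) (ecost _ _) => X Y c1 c2 L.
have l3 : (20 + ctime c N) * (z + cgrow c N + 1) <= (20 + ctime c z) * (z + cgrow c z + 1).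
  by apply: leq_mul; lia.
apply: leq_trans l3; rewrite mulnDl.
by move: c1 c2 L b0; move: (z + _ + 1) => u; nia.
Qed.

(** * Clusterings *)

Section Clustering.
Variables (N : nat) (ty : nat -> nat) (dl : nat -> nat -> nat -> bool).
Hypothesis dl_refl : forall q u, u < N -> dl q u u.
Hypothesis dl_sym : forall q u v, u < N -> v < N -> dl q u v -> dl q v u.
Hypothesis dl_tri : forall p q u v w, u < N -> v < N -> w < N ->
  dl p u v -> dl q v w -> dl (p + q) u w.

(* A partial clustering: [cov v] tells whether [v] is covered, [cl v] is the  *)
(* index of its cluster, [cen i] the center of cluster [i], and the last tree *)
(* started, that of cluster [m.-1], is the only one that may still grow.      *)
Record pclust (cov : nat -> nat) m (cen cl par root : nat -> nat) : Prop := PClust {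
  g_cen : forall i, i < m -> cen i < N;
  g_cl : forall v, v < N -> cov v != 0 -> cl v < m /\ dl 2 v (cen (cl v));
  g_near : forall v i, v < N -> i < m -> dl 1 v (cen i) -> cov v != 0 /\ cl v = i;
  g_cov : forall v i, v < N -> i < m -> dl 2 v (cen i) -> cov v != 0;
  g_par : forall i, i < m -> (par i = i /\ root i = i) \/
     [/\ par i < i, root (par i) = root i & dl 3 (cen i) (cen (par i))];
  g_tree : forall u v, u < N -> v < N -> cov u != 0 -> cov v != 0 -> dl 1 u v ->
     root (cl u) = root (cl v);
  g_front : forall v i, v < N -> i < m -> cov v = 0 -> dl 3 v (cen i) ->
     root i = root m.-1;
  g_unc : forall v, v < N -> cov v != 0 -> ty v = 0 -> ty (cen (root (cl v))) = 0;
  g_rest : 0 < m -> ty (cen (root m.-1)) != 0 ->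
     forall v, v < N -> cov v = 0 -> ty v != 0 }.

(** [P] stands for the distance clause, so that the lemma serves both [pclust] and [clustering]. *)
Lemma root_le m (par root : nat -> nat) (P : nat -> Prop) :
  (forall i, i < m -> (par i = i /\ root i = i) \/
     [/\ par i < i, root (par i) = root i & P i]) ->
  forall i, i < m -> root i <= i /\ par (root i) = root i.
Proof.
move=> H i; elim/ltn_ind: i => i IH im.
case: (H i im) => [[h1 h2]|[h1 h2 _]]; first by rewrite h2.
by case: (IH _ h1 (ltn_trans h1 im)); rewrite h2 => h3 h4; split=> //; lia.
Qed.

Lemma pclust0 cov cen cl par root : (forall v, v < N -> cov v = 0) ->
  pclust cov 0 cen cl par root.
Proof. by move=> h; split=> // [v /h ->|u v /h ->|v /h ->]. Qed.

(** No step of length at most r may join two trees. This could only fail at a newly covered node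
    next to a covered one; such a node lies within 3r of an old center, hence of the last tree, and
    then the new center joins that tree as well. *)
Lemma pclust_extend cov m cen cl par root c cov' cen' cl' par' root' :
  pclust cov m cen cl par root -> c < N -> cov c = 0 ->
  cen' m = c ->
  (forall i, i < m -> [/\ cen' i = cen i, par' i = par i & root' i = root i]) ->
  [\/ exists p, [/\ p < m, dl 3 c (cen p), par' m = p & root' m = root p]
    | [/\ forall u i, u < N -> i < m -> cov u = 0 -> ~~ dl 3 u (cen i),
          par' m = m, root' m = m
        & ty c = 0 \/ forall u, u < N -> cov u = 0 -> ty u != 0]] ->
  (forall w, w < N ->
     if dl 1 w c || (cov w == 0) && dl 2 w c then cov' w != 0 /\ cl' w = m
     else cov' w = cov w /\ cl' w = cl w) ->
  pclust cov' m.+1 cen' cl' par' root'.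
Proof.
move=> G cN c0 cenm old sel new.
have G_root := root_le (g_par G).
have cen'lt i : i < m -> cen' i = cen i by move/old => [].
have rootE i : i < m -> root' i = root i by move/old => [].
(* An uncovered u next to a covered w is within 1 + 2 = 3 radii of the center of w, so [g_front]
   puts w in the last tree; if a new tree is being started, there is no such pair. *)
have K1 u w : u < N -> w < N -> cov u = 0 -> cov w != 0 -> dl 1 u w ->
    root (cl w) = root' m.
  move=> uN wN u0 w0 uw; have [lw dw] := g_cl G wN w0.
  have d3 : dl 3 u (cen (cl w)) by apply: (dl_tri uN wN (g_cen G lw) uw dw).
  case: sel => [[p [pm dp _ ->]]|[no _ _ _]].
    by rewrite (g_front G uN lw u0 d3) (g_front G cN pm c0 dp).
  by have := no _ _ uN lw u0; rewrite d3.
(* A covered node may be recaptured by c, but being next to the uncovered c it stays in the same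
   tree. *)
have tau w : w < N -> cov w != 0 -> root' (cl' w) = root (cl w).
  move=> wN w0; move: (new w wN); case: ifP => [|_ [_ ->]].
    rewrite (negbTE w0) orbF => d1 [_ ->]; rewrite (K1 c w) //.
    exact: dl_sym.
  by apply: rootE; case: (g_cl G wN w0).
have tau' w : w < N -> cov w = 0 -> cov' w != 0 -> root' (cl' w) = root' m.
  by move=> wN w0; move: (new w wN); case: ifP => _ [-> ->] //; rewrite w0.
have covS w : w < N -> cov w != 0 -> cov' w != 0.
  by move=> wN w0; move: (new w wN); case: ifP => _ [h _] //; rewrite h.
have covS0 w : w < N -> cov' w = 0 -> cov w = 0.
  by move=> wN w0; apply/eqP; apply/negPn/negP => /(covS _ wN); rewrite w0.
have unc0 u : u < N -> cov u = 0 -> ty (cen' (root' m)) != 0 -> ty u != 0.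
  move=> uN u0; case: sel => [[p [pm dp _ rm]]|[_ _ -> [h|h]]]; last first.
  - by move=> _; apply: h.
  - by rewrite cenm h.
  have E := g_front G cN pm c0 dp; rewrite rm E.
  have m0 : 0 < m by lia.
  have [l1 _] := G_root m.-1 ltac:(lia).
  by rewrite cen'lt; [move=> h; apply: (g_rest G m0 h) | lia].
split.
- by move=> i; rewrite ltnS leq_eqVlt => /orP[/eqP ->|h]; [rewrite cenm | rewrite cen'lt // (g_cen G)].
- move=> v vN; move: (new v vN); case: ifP => [h [_ ->] _|h [-> ->] /(g_cl G vN)[h1 h2]].
    split=> //; rewrite cenm; case/orP: h => [h|/andP[] //].
    by apply: (dl_tri (p := 1) (q := 1) vN cN cN h); apply: dl_refl.
  by split; [lia | rewrite cen'lt].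
- move=> v i vN; rewrite ltnS leq_eqVlt => /orP[/eqP ->|im].
    by rewrite cenm => h; move: (new v vN); rewrite h.
  rewrite cen'lt // => h; have [v0 vi] := g_near G vN im h.
  move: (new v vN); case: ifP => [|_ [-> ->] //].
  rewrite (negbTE v0) orbF => d1; exfalso.
  (* A node within r of both c and an old center would put c within 2r of that center, where
     everything is already covered. So recapturing never takes a node from the r-ball of an old
     center. *)
  have: cov c != 0; last by rewrite c0.
  apply: (g_cov G cN im).
  by apply: (dl_tri (p := 1) (q := 1) cN vN (g_cen G im)) => //; apply: dl_sym.
- move=> v i vN; rewrite ltnS leq_eqVlt => /orP[/eqP ->|im].
    rewrite cenm => h; move: (new v vN); rewrite h andbT.
    by case: ifP => [_ []|/norP[_ h'] [-> _]].
  by rewrite cen'lt // => /(g_cov G vN im); apply: covS.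
- move=> i; rewrite ltnS leq_eqVlt => /orP[/eqP ->|im]; last first.
    case: (old i im) => -> -> ->; case: (g_par G im) => [|[h1 h2 h3]]; first by left.
    by right; rewrite rootE ?cen'lt //; apply: ltn_trans im.
  case: sel => [[p [pm dp -> ->]]|[_ -> -> _]]; last by left.
  by right; rewrite cenm rootE // cen'lt.
- move=> u v uN vN u1 v1 uv.
  case: (eqVneq (cov u) 0) => u0; case: (eqVneq (cov v) 0) => v0.
  + by rewrite !tau'.
  + by rewrite tau' // tau // (K1 u).
  + by rewrite (tau u) // tau' // (K1 v) //; apply: dl_sym.
  + by rewrite !tau //; apply: (g_tree G).
- move=> v i vN; rewrite ltnS leq_eqVlt => /orP[/eqP ->|im] // v0.
  have v0' := covS0 _ vN v0.
  rewrite cen'lt // rootE //= => d3; case: sel => [[p [pm dp _ ->]]|[no _ _ _]].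
    by rewrite (g_front G vN im v0' d3) (g_front G cN pm c0 dp).
  by have := no _ _ vN im v0'; rewrite d3.
- move=> v vN v1 t0; case: (eqVneq (cov v) 0) => v0.
    rewrite tau' //; apply/eqP; apply/negPn/negP => h.
    by have := unc0 _ vN v0 h; rewrite t0.
  rewrite tau // cen'lt ?(g_unc G) //.
  have [l1 _] := g_cl G vN v0; have [l2 _] := G_root _ l1; lia.
- by move=> _ /= h v vN /(covS0 _ vN) v0; apply: unc0.
Qed.

(** The lower bound rests on [c_near], which forces any solution of radius r to open a center in
    each cluster, on [c_tree], which confines its assignment to trees, and on [c_unc], which makes a
    tree with constrained root wholly constrained. *)
Record clustering m (cen cl par root : nat -> nat) : Prop := Clustering {
  c_cen : forall i, i < m -> cen i < N;
  c_cl : forall v, v < N -> cl v < m;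
  c_dist : forall v, v < N -> dl 2 v (cen (cl v));
  c_near : forall v i, v < N -> i < m -> dl 1 v (cen i) -> cl v = i;
  c_par : forall i, i < m -> (par i = i /\ root i = i) \/
     [/\ par i < i, root (par i) = root i & dl 3 (cen i) (cen (par i))];
  c_tree : forall u v, u < N -> v < N -> dl 1 u v -> root (cl u) = root (cl v);
  c_unc : forall v, v < N -> ty v = 0 -> ty (cen (root (cl v))) = 0 }.

Lemma pclust_all cov m cen cl par root :
  pclust cov m cen cl par root -> (forall v, v < N -> cov v != 0) ->
  clustering m cen cl par root.
Proof.
move=> G h; split.
- exact: g_cen G.
- by move=> v vN; case: (g_cl G vN (h _ vN)).
- by move=> v vN; case: (g_cl G vN (h _ vN)).
- by move=> v i vN im d; case: (g_near G vN im d).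
- exact: g_par G.
- by move=> u v uN vN; apply: (g_tree G uN vN (h _ uN) (h _ vN)).
- by move=> v vN; apply: (g_unc G vN (h _ vN)).
Qed.

End Clustering.

(** * Sums over clusters and their parities *)

Lemma sum_delta n a (G : nat -> nat) :
  a < n -> \sum_(i < n) (val i == a) * G i = G a.
Proof.
move=> h; rewrite (bigD1 (Ordinal h)) //= eqxx mul1n big1 ?addn0 // => i.
by rewrite -val_eqE /= => /negbTE ->.
Qed.

Lemma sum_fiber n m (cl G : nat -> nat) : (forall v, v < n -> cl v < m) ->
  \sum_(v < n) G v = \sum_(i < m) \sum_(v < n) (cl v == i) * G v.
Proof.
move=> h; rewrite exchange_big /=; apply: eq_bigr => v _.
rewrite -[LHS](sum_delta (fun=> G v) (h v (ltn_ord v))).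
by apply: eq_bigr => i _; rewrite eq_sym.
Qed.

(** As [h] is a section of [cl], the nodes v with v = h (cl v) are in bijection with the clusters.
    It is applied to representatives and to the centers serving the cluster centers. *)
Lemma sum_section n m (cl h G : nat -> nat) : (forall v, v < n -> cl v < m) ->
  (forall i, i < m -> h i < n /\ cl (h i) = i) ->
  \sum_(v < n) (val v == h (cl v)) * G v = \sum_(i < m) G (h i).
Proof.
move=> hc hh; rewrite (sum_fiber (fun v => (v == h (cl v)) * G v) hc); apply: eq_bigr => i _.
have [h1 h2] := hh i (ltn_ord i).
rewrite -[RHS](sum_delta G h1); apply: eq_bigr => v _.
rewrite mulnA mulnb; congr (nat_of_bool _ * _).
case: (val v =P h i) => [->|E]; first by rewrite h2 !eqxx.
by case: (cl v =P i) => //= e; rewrite e; case: eqP E.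
Qed.

Lemma odd_sum n (f g : nat -> nat) : (forall i, i < n -> odd (f i) = odd (g i)) ->
  odd (\sum_(i < n) f i) = odd (\sum_(i < n) g i).
Proof.
move=> h; elim: n h => [|n IH] h; first by rewrite !big_ord0.
by rewrite !big_ord_recr /= !oddD h // IH // => i hi; apply: h; apply: ltnW.
Qed.

(** * Parity defects *)

Section Parity.
Variables (N : nat) (ty : nat -> nat) (dl : nat -> nat -> nat -> bool).
Hypothesis dl_refl : forall q u, u < N -> dl q u u.
Hypothesis dl_sym : forall q u v, u < N -> v < N -> dl q u v -> dl q v u.
Hypothesis dl_tri : forall p q u v w, u < N -> v < N -> w < N ->
  dl p u v -> dl q v w -> dl (p + q) u w.
Variables (m : nat) (cen cl par root : nat -> nat).
Hypothesis C : clustering N ty dl m cen cl par root.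
Variable rep : nat -> nat.
Hypothesis rep_cl : forall i, i < m -> rep i < N /\ cl (rep i) = i.

(* Whether the parity constraints contradict the number of clients of tree t, *)
(* when its root is constrained.                                              *)
Definition defect (t : nat) : bool :=
  (ty (cen t) != 0) &&
  odd (\sum_(v < N) (root (cl v) == t) +
       \sum_(i < m) ((root i == t) && (ty (rep i) == 1))).

Lemma rep_inj i j : i < m -> j < m -> (rep i == rep j) = (i == j).
Proof.
move=> im jm; apply/eqP/eqP => [E|-> //].
by have [_ <-] := rep_cl im; have [_ <-] := rep_cl jm; rewrite E.
Qed.

Lemma clusters_le : m <= N.
Proof.
rewrite -[m](card_ord) -[N in _ <= N](card_ord).
pose g (i : 'I_m) : 'I_N := Ordinal (proj1 (rep_cl (ltn_ord i))).
apply: (@leq_card _ _ g) => a b /(congr1 val) /= /eqP.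
by rewrite rep_inj // => /eqP; apply: val_inj.
Qed.

(** * The assignment obtained by pushing parity errors to the roots *)

Section Feasibility.
Variables e f0 f1 : nat -> nat.
Hypothesis rep_root : forall t, t < m -> root t = t -> ty (cen t) = 0 -> ty (rep t) = 0.
Hypothesis extra : forall w, w < N -> e w != 0 -> ty w = 1 /\ w <> rep (cl w).
Hypothesis balanced : forall t, t < N ->
  defect t = \sum_(w < N) ((e w != 0) && (root (cl w) == t)) :> nat.
Hypothesis f0E : forall i, i < m ->
  f0 i = odd (\sum_(v < N) ((cl v == i) && (e v == 0)) + (ty (rep i) == 1)) :> nat.
Hypothesis f1E : forall j, j < m ->
  f1 j = odd (f0 j + \sum_(i < m) ((par i == j) && (par i != i)) * f1 i) :> nat.
Hypothesis f1_root : forall t, t < m -> par t = t ->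
  f1 t = odd (\sum_(i < m) (root i == t) * f0 i) :> nat.

(** [f0 i] is the parity error of cluster i when all its nodes outside [e] go to [rep i], an
    unconstrained representative counting as even; [f1 i] is the error once the children have sent
    up their representatives. A wrong cluster below a root then sends its own. *)
Definition moved v :=
  [&& v == rep (cl v), par (cl v) != cl v & f1 (cl v) != 0].
(* The representative of a cluster is the client that moves to the parent.    *)
Definition sigma v :=
  if e v != 0 then v else if moved v then rep (par (cl v)) else rep (cl v).

Lemma par_lt i : i < m -> par i < m.
Proof.
by move=> im; case: (c_par C im) => [[->]|[h _ _]] //; apply: ltn_trans im.
Qed.

Lemma rep_e i : i < m -> e (rep i) = 0.
Proof.
move=> im; have [h1 h2] := rep_cl im; apply/eqP/negPn/negP => h.
by have [_] := extra h1 h; rewrite h2.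
Qed.

Lemma sigma_center v : v < N -> e (sigma v) != 0 \/ exists2 i, i < m & sigma v = rep i.
Proof.
move=> vN; rewrite /sigma; case: ifP => [h|_]; first by left.
have h := c_cl C vN.
by right; case: ifP => _; [exists (par (cl v)); rewrite ?par_lt | exists (cl v)].
Qed.

Lemma sigma_lt v : v < N -> sigma v < N.
Proof.
move=> vN; have h := c_cl C vN; rewrite /sigma; case: ifP => // _.
by case: ifP => _; case: (rep_cl h) => //; case: (rep_cl (par_lt h)).
Qed.

Lemma dl_rep i : i < m -> dl 2 (rep i) (cen i).
Proof. by move=> im; have [h1 h2] := rep_cl im; have := c_dist C h1; rewrite h2. Qed.

(** 7 = 2 + 3 + 2: from the parent's representative to the parent's center, on to the center of the
    cluster, and on to v. *)
Lemma sigma_dist v : v < N -> dl 7 (sigma v) v.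
Proof.
move=> vN; have h := c_cl C vN; have hp := par_lt h; rewrite /sigma.
have [hr _] := rep_cl h; have [hr' _] := rep_cl hp.
have hc := c_cen C h; have hc' := c_cen C hp.
case: ifP => _; first exact: dl_refl.
have d1 : dl 2 (cen (cl v)) v by apply: dl_sym => //; apply: c_dist C _ _.
case: ifP => [/and3P[_ h1 _]|_]; last first.
  (* Inside a cluster 2 + 2 radii suffice; the bound is padded by a trivial step of 3. *)
  have d2 := dl_tri (q := 3) hr vN vN (dl_tri hr hc vN (dl_rep h) d1).
  by apply: d2; apply: dl_refl.
case: (c_par C h) => [[E]|[_ _ d3]]; first by rewrite E eqxx in h1.
apply: (dl_tri (p := 5) (q := 2) hr' hc vN) => //.
apply: (dl_tri (p := 2) (q := 3) hr' hc' hc); first exact: dl_rep.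
exact: dl_sym.
Qed.

Lemma sigma_extra u : u < N -> e u != 0 -> \sum_(v < N) (sigma v == u) = 1.
Proof.
move=> uN ue; have [_ uE] := extra uN ue.
rewrite -[RHS](sum_delta (fun=> 1) uN); apply: eq_bigr => v _.
rewrite muln1; congr nat_of_bool; rewrite /sigma.
have h := c_cl C (ltn_ord v); case: ifP => // ve.
have vu : (val v == u) = false by apply/negP => /eqP E; rewrite -E ve in ue.
rewrite vu; apply/negP => /eqP E; apply: uE.
by case: ifP E => _ <-; [have [_ ->] := rep_cl (par_lt h) | have [_ ->] := rep_cl h].
Qed.

(** The clients of [rep j] are the nodes of cluster j outside [e], minus [rep j] if it moves up,
    plus the representatives sent by the children. Modulo 2 the recursion for [f1] cancels
    everything but the type of [rep j], except at a root, from which nothing can be sent up. *)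
Lemma sigma_rep j : j < m ->
  odd (\sum_(v < N) (sigma v == rep j)) =
  ((par j == j) && (f1 j != 0)) (+) (ty (rep j) == 1).
Proof.
move=> jm; pose x i := (par i != i) && (f1 i != 0).
pose A := \sum_(v < N) ((cl v == j) && (e v == 0)).
pose Y := \sum_(i < m) (x i && (par i == j)).
suff E : \sum_(v < N) (sigma v == rep j) + x j = A + Y.
  have f1b : f1 j = (f1 j != 0) by rewrite f1E //; case: (odd _).
  have oY : odd Y = odd (\sum_(i < m) ((par i == j) && (par i != i)) * f1 i).
    apply: (@odd_sum m (fun i => x i && (par i == j))
      (fun i => ((par i == j) && (par i != i)) * f1 i)) => i im; rewrite /x (f1E im).
    by case: (odd (f0 i + _)); case: (par i == i); case: (par i == j).
  have o1 := f1E jm; rewrite f1b in o1.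
  move/(congr1 odd): E; rewrite !oddD oY => E.
  have: (f1 j != 0) = odd (f0 j) (+) odd Y.
    by move: o1; rewrite oddD -oY; case: (f1 j != 0); case: (_ (+) _).
  rewrite f0E // oddb oddD -/A => o2; rewrite oddb /x in E.
  rewrite -oY in E.
  by move: E o2; case: (odd _); case: (odd A); case: (odd Y); case: (par j == j); case: (f1 j != 0); case: (ty _ == 1).
have xE : x j = \sum_(v < N) (val v == rep (cl v)) * (x (cl v) && (cl v == j)) :> nat.
  rewrite (@sum_section N m cl rep (fun v => x (cl v) && (cl v == j)) (c_cl C) rep_cl).
  rewrite -(sum_delta (fun i => x i) jm); apply: eq_bigr => i _.
  by have [_ ->] := rep_cl (ltn_ord i); rewrite mulnb andbC.
have YE : Y = \sum_(v < N) (val v == rep (cl v)) * (x (cl v) && (par (cl v) == j)).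
  rewrite (@sum_section N m cl rep (fun v => x (cl v) && (par (cl v) == j)) (c_cl C) rep_cl).
  by apply: eq_bigr => i _; have [_ ->] := rep_cl (ltn_ord i).
rewrite xE YE -!big_split /=; apply: eq_bigr => v _.
have h := c_cl C (ltn_ord v); have hp := par_lt h.
rewrite /sigma; case: (eqVneq (e v) 0) => ve /=.
  rewrite andbT /moved !mulnb -/(x _).
  case: (nat_of_ord v =P rep (cl v)) => [E|_] /=; last by rewrite rep_inj // !addn0.
  rewrite /x; case: (par (cl v) =P cl v) => /= [_|ne]; first by rewrite rep_inj // !addn0.
  case: (f1 (cl v) != 0) => /=; last by rewrite rep_inj // !addn0.
  by rewrite rep_inj // addnC.
rewrite andbF.
case: (nat_of_ord v =P rep (cl v)) => [E|_].
  by rewrite E rep_e in ve.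
rewrite !mul0n !addn0; case: eqP => // E.
by rewrite E rep_e in ve.
Qed.

(** Only a root can be wrong. If its center is unconstrained, so is its representative; otherwise
    its error is the defect of the tree corrected by the extra singletons, and [balanced] makes this
    even. *)
Lemma sigma_parity j : j < m -> ty (rep j) != 0 ->
  odd (\sum_(v < N) (sigma v == rep j)) = (ty (rep j) == 1).
Proof.
move=> jm t0; rewrite sigma_rep //.
suff -> : (par j == j) && (f1 j != 0) = false by [].
apply/negP => /andP[/eqP pj]; rewrite f1_root //.
have [hj|[hj _ _]] := c_par C jm; last by rewrite pj ltnn in hj.
have tc : ty (cen j) != 0.
  by apply/negP => /eqP h; move: t0; rewrite rep_root //; case: hj.
have jN := leq_trans jm clusters_le.
have o : odd (\sum_(i < m) (root i == j) * f0 i) =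
    odd (\sum_(v < N) ((root (cl v) == j) && (e v == 0)) +
         \sum_(i < m) ((root i == j) && (ty (rep i) == 1))).
  transitivity (odd (\sum_(i < m) (root i == j) * (\sum_(v < N) ((cl v == i) && (e v == 0)) + (ty (rep i) == 1)))).
    apply: (@odd_sum m (fun i => (root i == j) * f0 i)
       (fun i => (root i == j) * (\sum_(v < N) ((cl v == i) && (e v == 0)) + (ty (rep i) == 1)))) => i im.
    by rewrite !oddM f0E // !oddb.
  congr (odd _).
  rewrite (sum_fiber (fun v => (root (cl v) == j) && (e v == 0)) (c_cl C)).
  rewrite -big_split /=; apply: eq_bigr => i _.
  rewrite mulnDr mulnb big_distrr; congr (_ + _) => /=.
  apply: eq_bigr => v _; rewrite !mulnb.
  by case: (cl v =P i) => [->|_]; rewrite ?andbF.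
rewrite o.
have := balanced jN; rewrite /defect tc /=.
have -> : \sum_(v < N) (root (cl v) == j) =
    \sum_(v < N) ((root (cl v) == j) && (e v == 0)) +
    \sum_(v < N) ((e v != 0) && (root (cl v) == j)).
  rewrite -big_split /=; apply: eq_bigr => v _.
  by case: (e v == 0); rewrite /= ?andbT ?andbF ?addn0.
move: (\sum_(v < N) ((root (cl v) == j) && (e v == 0))) (\sum_(v < N) ((e v != 0) && (root (cl v) == j))) (\sum_(i < m) _) => X Y Z.
by rewrite !oddD => h; have := congr1 odd h; rewrite oddb; case: (odd X); case: (odd Y); case: (odd Z).
Qed.

End Feasibility.

(** * What a feasible solution of radius r must open *)

Section LowerBound.
Variables (S : nat -> bool) (sg : nat -> nat).
Hypothesis sg_lt : forall v, v < N -> sg v < N.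
Hypothesis sg_S : forall v, v < N -> S (sg v).
Hypothesis sg_dl : forall v, v < N -> dl 1 v (sg v).
Hypothesis sg_parity : forall u, u < N -> S u -> ty u != 0 ->
  odd (\sum_(v < N) (sg v == u)) = (ty u == 1).
Hypothesis same_type : forall w, w < N -> defect (root (cl w)) ->
  ty w = ty (rep (cl w)).

Lemma sg_cen i : i < m -> sg (cen i) < N /\ cl (sg (cen i)) = i.
Proof.
move=> im; have h := c_cen C im; split; first exact: sg_lt.
by apply: (c_near C) => //; [apply: sg_lt | apply: dl_sym => //; [apply: sg_lt|apply: sg_dl]].
Qed.

Lemma sg_tree v : v < N -> root (cl (sg v)) = root (cl v).
Proof. by move=> vN; apply/esym/(c_tree C) => //; [apply: sg_lt | apply: sg_dl]. Qed.

(** Count the nodes of the tree by the center that serves them: trees are preserved by [sg] and all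
    their nodes are constrained, so the count has the parity of the number of odd open centers. If
    each of these served its own cluster center, [same_type] would equate their number with that of
    the odd representatives, against the defect. *)
Lemma defect_witness t : defect t ->
  exists s, [/\ s < N, S s, root (cl s) = t, ty s = 1 & s != sg (cen (cl s))].
Proof.
move=> dt; pose P (s : 'I_N) := [&& S s, root (cl s) == t, ty s == 1 & val s != sg (cen (cl s))].
case: (pickP P) => [s /and4P[h1 /eqP h2 /eqP h3 h4]|none].
  by exists s; split.
exfalso; move: (dt); rewrite /defect => /andP[tc].
apply/negP; rewrite oddD.
suff -> : odd (\sum_(v < N) (root (cl v) == t)) = odd (\sum_(i < m) ((root i == t) && (ty (rep i) == 1))).
  by rewrite addbb.
transitivity (odd (\sum_(s < N) (root (cl s) == t) * \sum_(v < N) (sg v == s))).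
  congr odd; under [RHS]eq_bigr => s _ do rewrite big_distrr /=.
  rewrite exchange_big /=; apply: eq_bigr => v _.
  rewrite -(sg_tree (ltn_ord v)).
  rewrite -[LHS](sum_delta (fun s => root (cl s) == t) (sg_lt (ltn_ord v))).
  by apply: eq_bigr => s _; rewrite mulnC [sg v == _]eq_sym.
(* An unopened node serves nobody, and without a witness every open center of the tree other than
   those serving their cluster centers has an even number of clients. *)
transitivity (odd (\sum_(s < N) (val s == sg (cen (cl s))) * ((root (cl s) == t) && (ty s == 1)))).
  apply: (@odd_sum N (fun s => (root (cl s) == t) * \sum_(v < N) (sg v == s))
    (fun s => (s == sg (cen (cl s))) * ((root (cl s) == t) && (ty s == 1)))) => s sN.
  rewrite !oddM !oddb; case: (root (cl s) =P t) => [rt|] /=; last by rewrite andbF.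
  have ts : ty s != 0.
    by apply/negP => /eqP h; move: tc; rewrite -rt (c_unc C).
  case Ss: (S s).
    rewrite sg_parity //; have := none (Ordinal sN); rewrite /P /= Ss rt eqxx /=.
    by case: (ty s == 1); case: (s == _).
  rewrite big1 /=; last first.
    by move=> v _; case: eqP => // E; move: Ss; rewrite -E sg_S.
  case: eqP => // E; move: Ss; rewrite E sg_S //.
  by apply: (c_cen C); apply: (c_cl C).
rewrite (@sum_section N m cl (sg \o cen) (fun s => (root (cl s) == t) && (ty s == 1)) (c_cl C) sg_cen).
congr odd; apply: eq_bigr => i _ /=; have [h1 h2] := sg_cen (ltn_ord i).
rewrite h2; case: eqP => //= rt; congr (nat_of_bool (_ == _)).
by rewrite (same_type h1) h2 // rt.
Qed.

(** The witness is odd, and the center serving the center of its cluster has the same type. If odd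
    nodes were always representatives, both would be the representative of that cluster, but they
    differ. *)
Lemma defect_extra t : defect t ->
  (forall w, w < N -> root (cl w) = t -> ty w = 1 -> w = rep (cl w)) -> False.
Proof.
move=> dt H; have [s [sN Ss rt t1 ne]] := defect_witness dt.
have sE := H _ sN rt t1; have h := c_cl C sN; have [h1 h2] := sg_cen h.
have: sg (cen (cl s)) = rep (cl (sg (cen (cl s)))).
  by apply: H; rewrite ?h2 //; rewrite (same_type h1) h2 ?rt -?sE.
by rewrite h2 -sE => E; rewrite E eqxx in ne.
Qed.

(* The nodes [sg (cen i)] are m distinct centers, and each defective tree has *)
(* a further one.                                                             *)
Lemma centers_ge : m + \sum_(t < N) defect t <= \sum_(s < N) S s.
Proof.
have -> : \sum_(s < N) S s = \sum_(s < N) (val s == sg (cen (cl s))) * 1 +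
   \sum_(s < N) (S s && (val s != sg (cen (cl s)))).
  rewrite -big_split /=; apply: eq_bigr => s _.
  case: eqP => E /=; last by rewrite andbT mul0n.
  rewrite andbF muln1 addn0 E sg_S //.
  by apply: (c_cen C); apply: (c_cl C).
rewrite (@sum_section N m cl (sg \o cen) (fun=> 1) (c_cl C) sg_cen).
rewrite sum1_card card_ord leq_add2l.
have tN v : v < N -> root (cl v) < N.
  move=> vN; have h := c_cl C vN; have [h1 _] := root_le (c_par C) h.
  exact: leq_trans (leq_ltn_trans h1 h) clusters_le.
rewrite (@sum_fiber N N (root \o cl) (fun s => S s && (s != sg (cen (cl s)))) tN).
apply: leq_sum => t _; case dt: (defect t) => //.
have [s [sN Ss rt t1 ne]] := defect_witness dt.
by rewrite (bigD1 (Ordinal sN)) //= rt eqxx Ss ne.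
Qed.

End LowerBound.
End Parity.

(** * The program *)

Arguments upd T f x v y /.

Notation vU := 0 (only parsing).
Notation vV := 1 (only parsing).
Notation vJ := 2 (only parsing).
Notation vA := 3 (only parsing).
Notation vC := 4 (only parsing).
Notation vM := 5 (only parsing).
Notation vPri := 6 (only parsing).
Notation vCand := 7 (only parsing).
Notation vPar := 8 (only parsing).
Notation vCnt := 9 (only parsing).
Notation vOk := 10 (only parsing).
Notation vHave := 11 (only parsing).
Notation vBU := 12 (only parsing).
Notation vBV := 13 (only parsing).
Notation vI := 14 (only parsing).

Notation aCov := 0 (only parsing).
Notation aCl := 1 (only parsing).
Notation aCen := 2 (only parsing).
Notation aPar := 3 (only parsing).
Notation aRoot := 4 (only parsing).
Notation aQ := 5 (only parsing).
Notation aRep := 6 (only parsing).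
Notation aE := 7 (only parsing).
Notation aF := 8 (only parsing).
Notation aS := 9 (only parsing).
Notation aSg := 10 (only parsing).
Notation aBS := 11 (only parsing).
Notation aBSg := 12 (only parsing).

Declare Scope loop_scope.
Delimit Scope loop_scope with L.
Infix ";;" := LSeq (at level 61, right associativity) : loop_scope.
Infix "+" := (LOp OpAdd) : loop_scope.
Infix "-" := (LOp OpSub) : loop_scope.
Infix "*" := (LOp OpMul) : loop_scope.
Notation "$ x" := (LVar x) (at level 5, x at level 2) : loop_scope.
Notation "# m" := (LConst m) (at level 5, m at level 2) : loop_scope.
Notation "j .[ e ]" := (LArr j e) : loop_scope.
Notation "x <-- e" := (LSet x e) (at level 60) : loop_scope.
Bind Scope loop_scope with lexpr lcmd.
Open Scope loop_scope.

Definition eqE (a b : lexpr) := #1 - ((a - b) + (b - a)).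
Definition leE (a b : lexpr) := (b + #1) - a.
Definition ltE (a b : lexpr) := b - a.
Definition tyE (a : lexpr) := LInp (#2 + a).
Definition kE := LInp #1.
(** Offsets in the encoding: two header cells, one type per node, then two cells per matrix
    entry. *)
Definition numE (a b : lexpr) := LInp (#2 + LSize + #2 * (a * LSize + b)).
Definition denE (a b : lexpr) := LInp (#3 + LSize + #2 * (a * LSize + b)).
Definition within q (a b : lexpr) :=
  leE (numE a b * denE $vU $vV) (#q * (numE $vU $vV * denE a b)).
Definition When (e : lexpr) (c : lcmd) := LIf e c LSkip.
Definition Unless (e : lexpr) (c : lcmd) := LIf e LSkip c.


Definition init_cmd :=
  LFor vA (LPut aCov $vA #0 ;; LPut aQ $vA #0 ;; LPut aE $vA #0 ;;
           LPut aF $vA #0 ;; LPut aS $vA #0) ;;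
  vM <-- #0.

(* [vPri] ranks the candidate for the next center: 1 for any uncovered node,  *)
(* 2 for an unconstrained one, 3 for one within 3r of the center of a cluster,*)
(* which is then [vPar]; 0 means that all nodes are covered.                  *)
Definition pick_cmd :=
  When (eqE $vPri #0) (vPri <-- #1 ;; vCand <-- $vA) ;;
  When (eqE (tyE $vA) #0)
    (When (leE $vPri #1) (vPri <-- #2 ;; vCand <-- $vA)).

Definition scan_body :=
  When (ltE $vC $vM) (When (within 3 $vA aCen.[$vC])
    (vPri <-- #3 ;; vCand <-- $vA ;; vPar <-- $vC)).

Definition visit_cmd :=
  When (eqE aCov.[$vA] #0) (pick_cmd ;; LFor vC scan_body).

Definition select_cmd := vPri <-- #0 ;; LFor vA visit_cmd.

(** Nodes within r of the new center are taken even if already covered; those farther away, up to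
    2r, only if uncovered. *)
Definition cover_body :=
  LIf (within 1 $vA $vCand)
    (LPut aCl $vA $vM ;; LPut aCov $vA #1)
    (When (eqE aCov.[$vA] #0) (When (within 2 $vA $vCand)
      (LPut aCl $vA $vM ;; LPut aCov $vA #1))).

Definition link_cmd :=
  LPut aCen $vM $vCand ;;
  LIf (eqE $vPri #3)
      (LPut aPar $vM $vPar ;; LPut aRoot $vM aRoot.[$vPar])
      (LPut aPar $vM $vM ;; LPut aRoot $vM $vM).

Definition extend_cmd := link_cmd ;; LFor vA cover_body ;; vM <-- $vM + #1.

Definition greedy_cmd := LFor vJ (select_cmd ;; When $vPri extend_cmd).

Definition toggle j a := LPut j a (#1 - j.[a]).

Definition census_body :=
  When (tyE aCen.[aRoot.[aCl.[$vA]]]) (toggle aQ aRoot.[aCl.[$vA]]).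

Definition tally_body :=
  When (ltE $vA $vM) (
    LPut aRep $vA aCen.[$vA] ;;
    When (tyE aCen.[aRoot.[$vA]])
      (When (eqE (tyE aCen.[$vA]) #1) (toggle aQ aRoot.[$vA]))).

Definition parity_cmd := LFor vA census_body ;; LFor vA tally_body.

(** [aQ] flags the defective trees. One swap repairs a tree, so its flag is cleared at once. *)
Definition swap_cmd :=
  LFor vA (When aQ.[aRoot.[aCl.[$vA]]]
    (Unless (eqE (tyE $vA) (tyE aRep.[aCl.[$vA]]))
      (LPut aRep aCl.[$vA] $vA ;; LPut aQ aRoot.[aCl.[$vA]] #0))).

Definition extra_cmd :=
  vCnt <-- $vM ;;
  LFor vA (When aQ.[aRoot.[aCl.[$vA]]] (When (eqE (tyE $vA) #1)
    (Unless (eqE $vA aRep.[aCl.[$vA]])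
      (LPut aE $vA #1 ;; LPut aQ aRoot.[aCl.[$vA]] #0 ;;
       vCnt <-- $vCnt + #1)))).

Definition load_body := When (eqE aE.[$vA] #0) (toggle aF aCl.[$vA]).

Definition need_body :=
  When (ltE $vA $vM) (When (eqE (tyE aRep.[$vA]) #1) (toggle aF $vA)).

Definition flow_cmd := LFor vA load_body ;; LFor vA need_body.

(** Clusters are treated by decreasing index, hence children before parents. *)
Definition push_cmd :=
  LFor vA (vI <-- LSize - #1 - $vA ;;
    When (ltE $vI $vM) (Unless (eqE aPar.[$vI] $vI)
      (When aF.[$vI] (toggle aF aPar.[$vI])))).

Definition assign_body :=
  LIf aE.[$vA]
    (LPut aSg $vA $vA ;; LPut aS $vA #1)
    (LPut aSg $vA aRep.[aCl.[$vA]] ;;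
     When (eqE $vA aRep.[aCl.[$vA]]) (Unless (eqE aPar.[aCl.[$vA]] aCl.[$vA])
       (When aF.[aCl.[$vA]] (LPut aSg $vA aRep.[aPar.[aCl.[$vA]]])))).

Definition open_body := When (ltE $vA $vM) (LPut aS aRep.[$vA] #1).

Definition assign_cmd := LFor vA assign_body ;; LFor vA open_body.

Definition check_cmd :=
  vOk <-- #1 ;;
  LFor vA (When aQ.[$vA] (vOk <-- #0)) ;;
  When (ltE kE $vCnt) (vOk <-- #0).

Definition repair_cmd :=
  parity_cmd ;; swap_cmd ;; extra_cmd ;; flow_cmd ;; push_cmd ;; assign_cmd ;;
  check_cmd.

Definition attempt_cmd := init_cmd ;; greedy_cmd ;; repair_cmd.

Definition copy_body := LPut aBS $vA aS.[$vA] ;; LPut aBSg $vA aSg.[$vA].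

Definition save_cmd :=
  When $vOk (Unless ($vHave * within 1 $vBU $vBV)
    ((vHave <-- #1 ;; vBU <-- $vU ;; vBV <-- $vV) ;; LFor vA copy_body)).

Definition try_cmd := attempt_cmd ;; save_cmd.

(** This overwrites the instance, and therefore only runs after the whole search. *)
Definition output_body := LOut $vA aBS.[$vA] ;; LOut (LSize + $vA) aBSg.[$vA].

Definition main_cmd := LFor vU (LFor vV try_cmd) ;; LFor vA output_body.

Lemma wfc_main : wfc main_cmd.
Proof. by []. Qed.

Lemma eqEP N B s a b :
  (leval N B s (eqE a b) != 0) = (leval N B s a == leval N B s b).
Proof. by rewrite /eqE /=; lia. Qed.

Lemma leEP N B s a b :
  (leval N B s (leE a b) != 0) = (leval N B s a <= leval N B s b).
Proof. by rewrite /leE /=; lia. Qed.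

Lemma ltEP N B s a b :
  (leval N B s (ltE a b) != 0) = (leval N B s a < leval N B s b).
Proof. by rewrite /ltE /=; lia. Qed.

Lemma lrun_seq N B c1 c2 s :
  lrun N B (LSeq c1 c2) s = lrun N B c2 (lrun N B c1 s).
Proof. by []. Qed.

Lemma lrun_if N B e c1 c2 s : lrun N B (LIf e c1 c2) s =
  if leval N B s e != 0 then lrun N B c1 s else lrun N B c2 s.
Proof. by []. Qed.

Close Scope loop_scope.

(** * Correctness of the program on an instance given by number-indexed data *)

Section Spec.
Variables (N B k : nat) (xs ty : nat -> nat) (D : nat -> nat -> rat).
Hypothesis xs_k : xs (minn 1 B) = k.
Hypothesis xs_ty : forall v, v < N -> xs (minn (2 + v) B) = ty v.
Hypothesis xs_num : forall u v, u < N -> v < N ->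
  xs (minn (2 + N + 2 * (u * N + v)) B) = `|numq (D u v)|%N.
Hypothesis xs_den : forall u v, u < N -> v < N ->
  xs (minn (3 + N + 2 * (u * N + v)) B) = `|denq (D u v)|%N.
Hypothesis D_ge0 : forall u v, u < N -> v < N -> (0 <= D u v)%R.
Hypothesis D_refl : forall u, u < N -> D u u = 0%R.
Hypothesis D_sym : forall u v, u < N -> v < N -> D u v = D v u.
Hypothesis D_tri : forall u v w, u < N -> v < N -> w < N ->
  (D u w <= D u v + D v w)%R.
Hypothesis ty_le2 : forall v, v < N -> ty v <= 2.

Local Notation run := (lrun N B).
Local Notation ev := (leval N B).

Lemma rat_leE (x y : rat) q : (0 <= x)%R -> (0 <= y)%R ->
  (`|numq x| * `|denq y| <= q * (`|numq y| * `|denq x|))%N = (x <= q%:R * y)%R.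
Proof.
move=> x0 y0.
have ex : x = (`|numq x|%N%:R / `|denq x|%N%:R)%R.
  rewrite -[LHS]divq_num_den; congr (_ / _)%R.
    by rewrite -[in LHS](gez0_abs (_ : (0 <= numq x)%R)) ?numq_ge0 // pmulrn.
  by rewrite -[in LHS](absz_denq x) pmulrn.
have ey : y = (`|numq y|%N%:R / `|denq y|%N%:R)%R.
  rewrite -[LHS]divq_num_den; congr (_ / _)%R.
    by rewrite -[in LHS](gez0_abs (_ : (0 <= numq y)%R)) ?numq_ge0 // pmulrn.
  by rewrite -[in LHS](absz_denq y) pmulrn.
have dx : (0 < `|denq x|%N)%N by rewrite absz_gt0 denq_neq0.
have dy : (0 < `|denq y|%N)%N by rewrite absz_gt0 denq_neq0.
rewrite [in RHS]ex [in RHS]ey.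
move: `|numq x|%N `|denq x|%N `|numq y|%N `|denq y|%N dx dy => a b c d b0 d0.
rewrite GRing.mulrA Num.Theory.ler_pdivlMr ?Num.Theory.ltr0n //.
rewrite GRing.mulrAC Num.Theory.ler_pdivrMr ?Num.Theory.ltr0n //.
by rewrite -!GRing.natrM Num.Theory.ler_nat mulnA.
Qed.

Record valid (R : rat) (S sg : nat -> nat) : Prop := Valid {
  valid_card : \sum_(u < N) S u <= k;
  valid_bool : forall u, u < N -> S u <= 1;
  valid_center : forall v, v < N -> sg v < N /\ S (sg v) != 0;
  valid_parity : forall u, u < N -> S u != 0 -> ty u != 0 ->
    odd (\sum_(v < N) (sg v == u)) = (ty u == 1);
  valid_dist : forall v, v < N -> (D (sg v) v <= R)%R }.

Section Attempt.
Variables u0 v0 : nat.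
Hypothesis (u0N : u0 < N) (v0N : v0 < N).

Definition dl q a b := (D a b <= q%:R * D u0 v0)%R.

Lemma dl_refl q u : u < N -> dl q u u.
Proof. by move=> h; rewrite /dl D_refl // Num.Theory.mulr_ge0 ?Num.Theory.ler0n ?D_ge0. Qed.

Lemma dl_sym q u v : u < N -> v < N -> dl q u v -> dl q v u.
Proof. by move=> h1 h2; rewrite /dl D_sym. Qed.

Lemma dl_tri p q u v w : u < N -> v < N -> w < N ->
  dl p u v -> dl q v w -> dl (p + q) u w.
Proof.
move=> h1 h2 h3 d1 d2; apply: (Order.POrderTheory.le_trans (D_tri h1 h2 h3)).
by rewrite GRing.natrD GRing.mulrDl Num.Theory.lerD.
Qed.

Definition ctx s := [/\ inp s = xs, var s vU = u0 & var s vV = v0].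

Lemma withinP s q a b : ctx s -> ev s a < N -> ev s b < N ->
  (ev s (within q a b) != 0) = dl q (ev s a) (ev s b).
Proof.
case=> h1 h2 h3 ha hb; rewrite /within leEP /= h1 h2 h3.
by rewrite !xs_num // !xs_den // rat_leE // D_ge0.
Qed.

Lemma tyP s a : ctx s -> ev s a < N -> ev s (tyE a) = ty (ev s a).
Proof. by case=> h1 _ _ ha; rewrite /tyE /= h1 xs_ty. Qed.

#[global] Opaque eqE leE ltE tyE within.

Lemma ctx_agree c s s' : agree c s s' -> ~~ winp c -> vU \notin wvars c ->
  vV \notin wvars c -> ctx s -> ctx s'.
Proof. by case=> fv _ fi wi hU hV [h1 h2 h3]; split; rewrite ?fv ?fi. Qed.

Lemma init_spec s (s' := run init_cmd s) :
  [/\ var s' vM = 0, forall i, i < N -> arr s' aCov i = 0,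
      forall i, i < N -> arr s' aQ i = 0, forall i, i < N -> arr s' aE i = 0
    & forall i, i < N -> arr s' aF i = 0 /\ arr s' aS i = 0].
Proof.
rewrite {}/s' /init_cmd; set b := (LFor _ _).
pose Inv n s' := forall i, i < n -> [/\ arr s' aCov i = 0, arr s' aQ i = 0,
   arr s' aE i = 0, arr s' aF i = 0 & arr s' aS i = 0].
have H : Inv N (run b s).
  apply: for_inv => // n s' nN _ sn I i; rewrite ltnS leq_eqVlt /= sn.
  by rewrite !eqnE; case: eqP => //= _ h; apply: I.
by split=> // i /H [] *.
Qed.

(** Progress of the search is measured twice: nodes below [b1] have been ranked, and node-cluster
    pairs lexicographically before [(b2, i)] have been tested for distance 3r. A node is ranked
    before its pairs are tested, so the two differ in between. *)
Record sel m (cov cen : nat -> nat) b1 b2 i pr c p : Prop := Sel {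
  sel_0 : pr = 0 -> forall v, v < b1 -> cov v != 0;
  sel_c : pr != 0 -> c < N /\ cov c = 0;
  sel_2 : pr = 2 -> ty c = 0;
  sel_3 : pr = 3 -> p < m /\ dl 3 c (cen p);
  sel_ty : pr <= 1 -> forall v, v < b1 -> cov v = 0 -> ty v != 0;
  sel_dl : pr <= 2 -> forall v j, v < N -> j < m -> v < b2 \/ v = b2 /\ j < i ->
     cov v = 0 -> ~~ dl 3 v (cen j);
  sel_le : pr <= 3 }.

Lemma pick_spec s m cov cen n (s' := run pick_cmd s) :
  ctx s -> var s vA = n -> n < N -> cov n = 0 ->
  sel m cov cen n n 0 (var s vPri) (var s vCand) (var s vPar) ->
  sel m cov cen n.+1 n 0 (var s' vPri) (var s' vCand) (var s' vPar).
Proof.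
move=> cs sn nN c0 [i0 ic i2 i3 it id il].
rewrite {}/s' /pick_cmd lrun_seq; set s1 := run _ s.
have s1E : s1 = if var s vPri == 0 then setvar (setvar s vPri 1) vCand n else s.
  by rewrite /s1 /When lrun_if eqEP /= sn.
have hd s2 : ctx s2 -> var s2 vA = n -> var s2 vPri <> 0 ->
    (var s2 vPri <> 0 -> var s2 vCand < N /\ cov (var s2 vCand) = 0) ->
  (var s2 vPri <= 2 -> var s vPri <= 2) ->
  (var s2 vPri <= 1 -> var s vPri <= 1) ->
  (var s2 vPri = 2 -> ty (var s2 vCand) = 0) ->
  (var s2 vPri = 3 -> var s2 vPar < m /\ dl 3 (var s2 vCand) (cen (var s2 vPar))) ->
  var s2 vPri <= 3 -> (var s2 vPri <= 1 -> ty n != 0) ->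
  sel m cov cen n.+1 n 0 (var s2 vPri) (var s2 vCand) (var s2 vPar).
  move=> c2 a2 p0 pc l2 l1 t2 t3 le ln.
  split=> [/p0 //|/eqP/pc //|//|//|h v|/l2/id //|//].
  rewrite ltnS leq_eqVlt => /orP[/eqP -> _|]; first exact: ln.
  by apply: it; apply: l1.
have [cs1 a1] : ctx s1 /\ var s1 vA = n.
by case: cs => h1 h2 h3; rewrite s1E /ctx; case: ifP.
have h1 : [/\ var s1 vPri <> 0, var s1 vCand < N /\ cov (var s1 vCand) = 0,
   (var s1 vPri = var s vPri /\ var s1 vCand = var s vCand \/ var s1 vPri = 1 /\ var s vPri = 0)
   & var s1 vPar = var s vPar].
  rewrite s1E; case: ifP => /= [/eqP h|/negbT h]; first by split=> //; right.
  by split; [apply/eqP | apply: ic | left |].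
case: h1 => p1 c1 e1 e2.
rewrite /When lrun_if eqEP tyP /= ?a1 //.
case: (ty n =P 0) => [t0|/eqP t0]; last first.
  case: e1 => [[e3 e4]|[e3 e4]]; (apply: hd => //; rewrite ?e3 ?e4 ?e2 //).
rewrite leEP /= ?a1.
case: ifP => /= l1.
  case: cs1 => *; apply: (hd (setvar (setvar s1 vPri 2) vCand n)) => //=.
  by move=> _; case: e1 => [[e3 e4]|[e3 e4]]; lia.
case: e1 => [[e3 e4]|[e3 e4]]; last by rewrite e3 in l1.
by apply: hd => //; rewrite ?e3 ?e4 ?e2 //; move: l1; rewrite e3 => ->.
Qed.

Lemma scan_spec s m cov cen n (s' := run (LFor vC scan_body) s) :
  ctx s -> var s vM = m -> arr s aCen = cen -> (forall i, i < m -> cen i < N) ->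
  var s vA = n -> n < N -> cov n = 0 ->
  sel m cov cen n.+1 n 0 (var s vPri) (var s vCand) (var s vPar) ->
  sel m cov cen n.+1 n N (var s' vPri) (var s' vCand) (var s' vPar).
Proof.
move=> cs hm hcen cenN sn nN c0 S; rewrite {}/s'.
pose Inv i s' := sel m cov cen n.+1 n i (var s' vPri) (var s' vCand) (var s' vPar).
apply: (@for_inv N B Inv) => // i s' iN ag si I.
have cs' : ctx s' by apply: (ctx_agree ag).
case: (ag) => fv fa fi.
have hm' : var s' vM = m by rewrite fv.
have hn' : var s' vA = n by rewrite fv.
have hcen' : arr s' aCen = cen by rewrite fa.
rewrite /Inv /scan_body /When lrun_if ltEP /= si hm'.
case: (ltnP i m) => im; last first.
  case: I => i0 ic i2 i3 it id il; split=> //=.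
  move=> h v j vN jm h'; apply: id => //; case: h' => [|[-> _]]; first by left.
  by right; split=> //; lia.
rewrite withinP //= ?hn' ?hcen' ?si ?cenN //.
case: ifP => d3 /=; last first.
  case: I => i0 ic i2 i3 it id il; split=> //=.
  move=> h v j vN jm [h'|[-> h']] cv; first by apply: id => //; left.
  move: h'; rewrite ltnS leq_eqVlt => /orP[/eqP ->|h']; first by rewrite d3.
  by apply: id => //; right.
by split.
Qed.

Lemma select_spec s m cov cen (s' := run select_cmd s) :
  ctx s -> var s vM = m -> arr s aCov = cov -> arr s aCen = cen ->
  (forall i, i < m -> cen i < N) -> m <= N ->
  sel m cov cen N N 0 (var s' vPri) (var s' vCand) (var s' vPar).
Proof.
move=> cs hm hcov hcen cenN mN.
rewrite {}/s' /select_cmd lrun_seq.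
set s1 := run _ s.
pose Inv n s' := sel m cov cen n n 0 (var s' vPri) (var s' vCand) (var s' vPar).
apply: (@for_inv N B Inv vA visit_cmd s1) => //.
  by split=> // [_ v j _ _ [|[]]].
move=> n s' nN ag sn I.
have cs1 : ctx s1 by case: cs.
have cs' : ctx s' by apply: (ctx_agree ag).
case: (ag) => fv fa fi.
have hm' : var s' vM = m by rewrite fv.
have hcov' : arr s' aCov = cov by rewrite fa.
have hcen' : arr s' aCen = cen by rewrite fa.
rewrite /Inv /visit_cmd /When lrun_if eqEP [ev _ _]/= [ev _ (LConst _)]/= sn hcov'.
case: (cov n =P 0) => [c0|/eqP c0]; last first.
  case: I => i0 ic i2 i3 it id il; split=> //=.
  - by move=> /i0 h v; rewrite ltnS leq_eqVlt => /orP[/eqP -> //|]; apply: h.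
  - move=> /it h v; rewrite ltnS leq_eqVlt => /orP[/eqP -> |]; last exact: h.
    by move=> h'; rewrite h' in c0.
  - move=> /id h v j vN jm [|[_ //]]; rewrite ltnS leq_eqVlt => /orP[/eqP -> |h'].
      by move=> h'; rewrite h' in c0.
    by apply: h => //; left.
rewrite lrun_seq; set s3 := run pick_cmd s'.
have A3 := lrun_agree N B pick_cmd s'; case: (A3) => gv ga _.
have P3 := pick_spec cs' sn nN c0 I.
have cs3 : ctx s3 by apply: (ctx_agree A3).
have H : sel m cov cen n.+1 n N (var (run (LFor vC scan_body) s3) vPri)
    (var (run (LFor vC scan_body) s3) vCand) (var (run (LFor vC scan_body) s3) vPar).
  by apply: scan_spec => //; rewrite /s3 ?gv ?ga.
case: H => i0 ic i2 i3 it id il; split=> //.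
move=> /id h v j vN jm [|[_ //]]; rewrite ltnS leq_eqVlt => /orP[/eqP -> |h'].
  by apply: h => //; right; split=> //; lia.
by apply: h => //; left.
Qed.

Lemma cover_spec s m c cov cl (s' := run (LFor vA cover_body) s) :
  ctx s -> var s vM = m -> var s vCand = c -> c < N ->
  arr s aCov = cov -> arr s aCl = cl -> forall w, w < N ->
  if dl 1 w c || (cov w == 0) && dl 2 w c then arr s' aCov w != 0 /\ arr s' aCl w = m
  else arr s' aCov w = cov w /\ arr s' aCl w = cl w.
Proof.
move=> cs hm hc cN hcov hcl; rewrite {}/s'.
pose Inv n s' := forall w, w < N ->
  if (w < n) && (dl 1 w c || (cov w == 0) && dl 2 w c)
  then arr s' aCov w != 0 /\ arr s' aCl w = m
  else arr s' aCov w = cov w /\ arr s' aCl w = cl w.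
suff H : Inv N (run (LFor vA cover_body) s) by move=> w wN; have := H w wN; rewrite wN.
apply: for_inv => //.
  by move=> w wN /=; rewrite hcov hcl.
move=> n s' nN ag sn I w wN.
have cs' : ctx s' by apply: (ctx_agree ag).
case: (ag) => fv _ _.
have hm' : var s' vM = m by rewrite fv.
have hc' : var s' vCand = c by rewrite fv.
have In := I n nN; rewrite ltnn /= in In; case: In => In1 In2.
have stepE : run cover_body s' =
  if dl 1 n c || (cov n == 0) && dl 2 n c
  then setarr (setarr s' aCl n m) aCov n 1 else s'.
  rewrite /cover_body /When lrun_if withinP /= ?sn ?hc' ?hm' //; case: (dl 1 n c) => //=.
  rewrite eqEP /= sn In1; case: (cov n == 0) => //=.
  by rewrite withinP /= ?sn ?hc'.
rewrite stepE; have Iw := I w wN.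
case: (w =P n) => [->|ne].
  by rewrite ltnSn /=; case: (dl 1 n c || _) => /=; rewrite ?In1 ?In2 ?eqnE ?eqxx.
have wn : (w == n) = false by apply/eqP.
have -> : (w < n.+1) = (w < n) by rewrite ltnS leq_eqVlt wn.
by case: (dl 1 n c || _) => //=; rewrite !eqnE wn.
Qed.

Lemma link_spec s m c p cen par root (s' := run link_cmd s) :
  var s vM = m -> var s vCand = c -> var s vPar = p -> 
  arr s aCen = cen -> arr s aPar = par -> arr s aRoot = root ->
  [/\ forall i, arr s' aCen i = if i == m then c else cen i,
      forall i, arr s' aPar i = if i == m then (if var s vPri == 3 then p else m) else par i
    & forall i, arr s' aRoot i = if i == m then (if var s vPri == 3 then root p else m) else root i].
Proof.
move=> hm hc hp hcen hpar hroot.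
rewrite {}/s' /link_cmd lrun_seq lrun_if eqEP.
have -> : ev (run (LPut aCen (LVar vM) (LVar vCand)) s) (LVar vPri) = var s vPri by [].
rewrite [ev _ (LConst _)]/=; case: eqP => _; split=> i /=;
  by rewrite !eqnE ?hm ?hc ?hp ?hcen ?hpar ?hroot.
Qed.

(** The last clause measures progress: each round covers a new node unless all are covered, so [N]
    rounds suffice. *)
Definition ginv s j :=
  [/\ ctx s, var s vM <= j,
      pclust N ty dl (arr s aCov) (var s vM) (arr s aCen) (arr s aCl) (arr s aPar) (arr s aRoot)
    & (forall v, v < N -> arr s aCov v != 0) \/ j <= \sum_(v < N) (arr s aCov v != 0)].

Lemma greedy_step s j : j < N -> ginv s j ->
  ginv (run (LSeq select_cmd (When (LVar vPri) extend_cmd)) s) j.+1.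
Proof.
move=> jN [cs mj G cnt].
rewrite [run (LSeq _ _) s]lrun_seq; set s1 := run select_cmd s.
have A1 := lrun_agree N B select_cmd s; case: (A1) => fv fa _.
have S1 : sel (var s vM) (arr s aCov) (arr s aCen) N N 0 (var s1 vPri) (var s1 vCand) (var s1 vPar).
  by apply: select_spec => //; [apply: (g_cen G) | lia].
have cs1 : ctx s1 by apply: (ctx_agree A1).
have mE : var s1 vM = var s vM by rewrite /s1 fv.
have aE j' : j' \notin [::] -> arr s1 j' = arr s j' by move=> h; rewrite /s1 fa.
rewrite /When lrun_if [ev _ _]/=; case: ifP => [p0|/negbFE/eqP p0]; last first.
  rewrite [run LSkip _]/=; split=> //; rewrite ?mE ?aE //; first by lia.
  by left; apply: (sel_0 S1).
have [cN c0] := sel_c S1 p0.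
rewrite /extend_cmd lrun_seq lrun_seq; set s2 := run link_cmd s1; set s3 := run _ s2.
have A2 := lrun_agree N B link_cmd s1; case: (A2) => gv ga _.
have A3 := lrun_agree N B (LFor vA cover_body) s2; case: (A3) => hv ha _.
have cs2 : ctx s2 by apply: (ctx_agree A2).
have cs3 : ctx s3 by apply: (ctx_agree A3).
have mE3 : var s3 vM = var s vM by rewrite /s3 hv // /s2 gv.
have L : [/\ forall i, arr s3 aCen i = if i == var s vM then var s1 vCand else arr s aCen i,
      forall i, arr s3 aPar i = if i == var s vM then (if var s1 vPri == 3 then var s1 vPar else var s vM) else arr s aPar i
    & forall i, arr s3 aRoot i = if i == var s vM then (if var s1 vPri == 3 then arr s aRoot (var s1 vPar) else var s vM) else arr s aRoot i].
  rewrite /s3 !ha //.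
  by apply: link_spec => //; rewrite aE.
have K : forall w, w < N ->
  if dl 1 w (var s1 vCand) || (arr s aCov w == 0) && dl 2 w (var s1 vCand)
  then arr s3 aCov w != 0 /\ arr s3 aCl w = var s vM
  else arr s3 aCov w = arr s aCov w /\ arr s3 aCl w = arr s aCl w.
  by apply: cover_spec => //; rewrite /s2 ?gv ?ga // ?aE.
case: L => Lc Lp Lr.
have G' : pclust N ty dl (arr s3 aCov) (var s vM).+1 (arr s3 aCen) (arr s3 aCl) (arr s3 aPar) (arr s3 aRoot).
  apply: (pclust_extend dl_refl dl_sym dl_tri G cN c0 _ _ _ K).
  - by rewrite Lc eqxx.
  - by move=> i im; rewrite Lc Lp Lr ltn_eqF.
  rewrite Lp Lr eqxx; case: (var s1 vPri =P 3) => p3.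
    by left; have [h1 h2] := sel_3 S1 p3; exists (var s1 vPar).
  have l2 : var s1 vPri <= 2 by have := sel_le S1; lia.
  right; split=> //.
    by move=> u i uN im u0'; apply: (sel_dl S1) => //; left.
  case: (var s1 vPri =P 2) => p2; first by left; apply: (sel_2 S1).
  by right=> u uN; apply: (sel_ty S1) => //; lia.
split.
- by case: cs3.
- by rewrite /= mE3; lia.
- by rewrite [var _ _]/= mE3 addn1.
right=> /=.
case: cnt => [/(_ _ cN)|cnt]; first by rewrite c0.
(* The new center was uncovered and covers itself, which accounts for one more node. *)
apply: (@leq_trans (\sum_(v < N) ((arr s aCov v != 0) + (val v == var s1 vCand) * 1))).
  by rewrite big_split /= (sum_delta (fun=> 1) cN) addn1.
apply: leq_sum => v _; have := K v (ltn_ord v); case: ifP => [_ [-> _]|h [-> _]].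
  rewrite /= muln1; case: (nat_of_ord v =P _) => [->|_]; last by case: (_ != 0).
  by rewrite c0.
rewrite muln1; case: (nat_of_ord v =P _) => [E|_]; last by rewrite addn0.
by move: h; rewrite E dl_refl.
Qed.

Lemma greedy_spec s (s' := run greedy_cmd s) :
  ctx s -> var s vM = 0 -> (forall v, v < N -> arr s aCov v = 0) ->
  clustering N ty dl (var s' vM) (arr s' aCen) (arr s' aCl) (arr s' aPar) (arr s' aRoot).
Proof.
move=> cs m0 c0; rewrite {}/s'.
have [_ mN G cnt] : ginv (run greedy_cmd s) N.
  apply: (@for_inv N B (fun n s => ginv s n)) => //.
    split.
    - by case: cs.
    - by rewrite /= m0.
    - by rewrite [var _ _]/= m0; apply: pclust0.
    - by right.
  move=> i s' iN ag si I; have [h1 h2 h3 h4] := greedy_step iN I.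
  by split=> //; case: h1.
apply: (pclust_all G) => v vN.
case: cnt => [|cnt]; first exact.
apply/negP => /eqP v1.
suff: \sum_(v < N) (arr (run greedy_cmd s) aCov v != 0) < \sum_(v < N) 1.
  by rewrite sum1_card card_ord; lia.
rewrite (bigD1 (Ordinal vN)) //= [X in _ < X](bigD1 (Ordinal vN)) //= v1 /= ltnS.
by apply: leq_sum => i _; case: (_ != 0).
Qed.

(** * Repairing parities on a fixed cluster forest *)

Section Tree.
Variables (m : nat) (cen cl par root : nat -> nat).
Hypothesis C : clustering N ty dl m cen cl par root.

Local Notation dft := (defect N ty m cen cl root).

Lemma cen_cl i : i < m -> cen i < N /\ cl (cen i) = i.
Proof.
move=> im; have h := c_cen C im; split=> //.
by apply: (c_near C) => //; apply: dl_refl.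
Qed.

Lemma m_le : m <= N.
Proof. exact: clusters_le cen_cl. Qed.

Lemma root_lt i : i < m -> root i < m.
Proof. by move=> im; have [h _] := root_le (c_par C) im; apply: leq_ltn_trans im. Qed.

Lemma tree_lt v : v < N -> root (cl v) < m.
Proof. by move=> vN; apply: root_lt; apply: (c_cl C). Qed.

Record lay s : Prop := Lay {
  lay_ctx : ctx s;
  lay_m : var s vM = m;
  lay_cen : arr s aCen = cen;
  lay_cl : arr s aCl = cl;
  lay_par : arr s aPar = par;
  lay_root : arr s aRoot = root }.

Definition keeps c := [&& ~~ winp c, vU \notin wvars c, vV \notin wvars c,
  vM \notin wvars c & all (fun j => j \notin warrs c) [:: aCen; aCl; aPar; aRoot]].

Lemma lay_agree c s s' : agree c s s' -> keeps c -> lay s -> lay s'.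
Proof.
move=> ag /and5P[k1 k2 k3 k4 k5] [h1 h2 h3 h4 h5 h6]; case: (ag) => fv fa fi.
move: k5; rewrite /= => /and5P[a1 a2 a3 a4 _].
by split; rewrite ?fv ?fa //; apply: (ctx_agree ag).
Qed.

Lemma odd_succ x : 1 - odd x = odd x.+1.
Proof. by rewrite /=; case: (odd x). Qed.

Lemma sum_guard (P : nat -> bool) :
  \sum_(i < N) ((i < m) && P i) = \sum_(i < m) P i.
Proof.
rewrite (big_ord_widen N (fun i => nat_of_bool (P i)) m_le) [RHS]big_mkcond /=.
by apply: eq_bigr => i _; case: (i < m).
Qed.

Lemma parity_spec s (s' := run parity_cmd s) :
  lay s -> (forall t, t < N -> arr s aQ t = 0) ->
  (forall t, t < N -> arr s' aQ t = dft cen t) /\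
  (forall i, i < m -> arr s' aRep i = cen i).
Proof.
move=> ls q0; rewrite {}/s' /parity_cmd lrun_seq.
set s1 := run _ s.
have ls1 : lay s1 by apply: (lay_agree (lrun_agree N B (LFor vA census_body) s)).
have q1 t : t < N -> arr s1 aQ t = (ty (cen t) != 0) && odd (\sum_(v < N) (root (cl v) == t)).
  move: t; pose Inv n s' := forall t, t < N ->
    arr s' aQ t = (ty (cen t) != 0) && odd (\sum_(v < n) (root (cl v) == t)).
  apply: (@for_inv N B Inv) => //.
    by move=> t tN; rewrite /= q0 // big_ord0 andbF.
  move=> n s' nN ag sn I t tN.
  have ls' : lay s' by apply: (lay_agree ag).
  have tn := tree_lt nN.
  have tE : ev s' (LArr aRoot (LArr aCl (LVar vA))) = root (cl n).
    by rewrite /= (lay_cl ls') (lay_root ls') sn.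
  have cE : ev s' (LArr aCen (LArr aRoot (LArr aCl (LVar vA)))) = cen (root (cl n)).
    by rewrite -tE /= (lay_cen ls').
  rewrite /census_body /When lrun_if tyP ?cE ?(c_cen C) //; last exact: (lay_ctx ls').
  rewrite big_ord_recr /=.
  case: (ty (cen (root (cl n))) =P 0) => /= t0.
    rewrite I //; case: (root (cl n) =P t) => [<-|_]; last by rewrite addn0.
    by rewrite t0.
  rewrite (lay_cl ls') (lay_root ls') sn !eqnE [t == _]eq_sym I ?(leq_trans tn m_le) //.
  case: (root (cl n) =P t) => [<-|_]; last by rewrite addn0 I.
  by move/eqP: t0 => -> /=; rewrite odd_succ addn1.
pose Inv n s' := (forall t, t < N -> arr s' aQ t = (ty (cen t) != 0) &&
    odd (\sum_(v < N) (root (cl v) == t) +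
         \sum_(i < n) ((i < m) && ((root i == t) && (ty (cen i) == 1)))) :> nat) /\
  (forall i, i < n -> i < m -> arr s' aRep i = cen i).
have [H1 H2] : Inv N (run (LFor vA tally_body) s1).
  apply: (@for_inv N B Inv) => //.
    by split=> // t tN; rewrite /= q1 // big_ord0 addn0.
  move=> n s' nN ag sn [I1 I2].
  have ls' : lay s' by apply: (lay_agree ag).
  rewrite /Inv /tally_body /When lrun_if ltEP [ev _ _]/= [ev _ (LVar vM)]/= sn (lay_m ls').
  case: ltnP => nm; last first.
    split=> [t tN|i]; first by rewrite big_ord_recr /= [n < m]ltnNge nm addn0 I1.
    by rewrite ltnS leq_eqVlt => /orP[/eqP ->|]; [rewrite ltnNge nm | apply: I2].
  rewrite lrun_seq; set s2 := run (LPut _ _ _) s'.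
  have ls2 : lay s2 by apply: (lay_agree (lrun_agree N B (LPut aRep (LVar vA) (LArr aCen (LVar vA))) s')).
  have rep2 i : i < n.+1 -> i < m -> arr s2 aRep i = cen i.
    rewrite ltnS leq_eqVlt /= sn (lay_cen ls') !eqnE.
    by case: eqP => [-> //|_ /= h]; apply: I2.
  have tn := root_lt nm.
  have sn2 : var s2 vA = n by [].
  rewrite -[arr s' aQ]/(arr s2 aQ) in I1; clearbody s2.
  have cs2 := lay_ctx ls2; have cN := c_cen C nm; have cN' := c_cen C tn.
  have E1 : ev s2 (LArr aCen (LArr aRoot (LVar vA))) = cen (root n).
    by rewrite /= (lay_cen ls2) (lay_root ls2) sn2.
  have E2 : ev s2 (LArr aCen (LVar vA)) = cen n by rewrite /= (lay_cen ls2) sn2.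
  rewrite lrun_if tyP ?E1 //.
  case: (ty (cen (root n)) =P 0) => /= t0.
    split=> // t tN; rewrite big_ord_recr /= nm I1 //=.
    by case: (root n =P t) => [<-|_]; [rewrite t0 | rewrite addn0].
  rewrite eqEP tyP ?E2 //.
  case: (ty (cen n) =P 1) => /= t1.
    split=> [t tN|i h1 h2]; last exact: rep2.
    rewrite (lay_root ls2) sn2 !eqnE [t == _]eq_sym big_ord_recr /= nm t1 eqxx andbT /=.
    case: (root n =P t) => [<-|_]; last by rewrite addn0 I1.
    rewrite I1 ?(leq_trans tn m_le) //; move/eqP: t0 => -> /=.
    by rewrite odd_succ -addnS addn1.
  split=> [t tN|i h1 h2]; last exact: rep2.
  by rewrite big_ord_recr /= nm I1 //; case: (ty (cen n) =P 1) => //; rewrite andbF addn0.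
split=> [t tN|i im]; last by apply: H2 => //; apply: leq_trans m_le.
by rewrite H1 // /defect (sum_guard (fun i => (root i == t) && (ty (cen i) == 1))).
Qed.

Lemma defect_upd rep i n t : i < m -> n < N -> cl n = i ->
  (forall j, j < m -> rep j < N /\ cl (rep j) = j) ->
  dft rep (root i) -> ty n <> ty (rep i) -> t < N ->
  dft (fun j => if j == i then n else rep j) t = (t != root i) && dft rep t.
Proof.
move=> im nN cln rep_cl dr ne tN; rewrite /defect.
case: (t =P root i) => [->|nt] /=; last first.
  congr (_ && odd (_ + _)); apply: eq_bigr => j _.
  by case: (nat_of_ord j =P i) => [->|//]; case: (root i =P t) => // E; case: nt.
have [tc od] := andP dr.
rewrite tc /=; apply: negbTE.
have E (r : nat -> nat) : \sum_(j < m) ((root j == root i) && (ty (r j) == 1)) =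
    (ty (r i) == 1) + \sum_(j < m | j != Ordinal im) ((root j == root i) && (ty (r j) == 1)).
  by rewrite (bigD1 (Ordinal im)) //= eqxx.
move: od; rewrite (E rep) (E (fun j => if j == i then n else rep j)) eqxx.
rewrite [X in _ -> is_true (~~ odd (_ + (_ + X)))](eq_bigr
    (fun j : 'I_m => nat_of_bool ((root j == root i) && (ty (rep j) == 1)))); last first.
  by move=> j; rewrite -val_eqE /= => /negbTE ->.
have constr v : v < N -> cl v = i -> (ty v == 1) = (ty v != 2).
  move=> vN cv; have := ty_le2 vN; have : ty v <> 0.
    by move=> h; move: tc; rewrite -cv (c_unc C).
  by case: (ty v) => [|[|[|]]].
have [r1 r2] := rep_cl _ im.
have: (ty n == 1) = ~~ (ty (rep i) == 1).
  have := constr _ nN cln; have := constr _ r1 r2; move: ne.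
  by case: (ty n =P 1) => [->|] ; case: (ty (rep i) =P 1) => [->|] // _ _ ne /esym/negbFE/eqP E1 /esym/negbFE/eqP E2; case: ne; rewrite E1 E2.
move=> ->; move: (\sum_(v < N) _) (\sum_(j < m | _) _) => X Y.
by rewrite !oddD !oddb; case: (odd X); case: (odd Y); case: (ty (rep i) == 1).
Qed.

(** The uniformity of types already checked survives later swaps, since the only tree a swap
    modifies ceases to be defective. *)
Lemma swap_spec s (s' := run swap_cmd s) (rep := arr s' aRep) :
  lay s -> (forall t, t < N -> arr s aQ t = dft cen t) ->
  (forall i, i < m -> arr s aRep i = cen i) ->
  [/\ forall i, i < m -> rep i < N /\ cl (rep i) = i,
      forall t, t < N -> arr s' aQ t = dft rep t,
      forall w, w < N -> dft rep (root (cl w)) -> ty w = ty (rep (cl w))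
    & forall t, t < m -> root t = t -> ty (cen t) = 0 -> ty (rep t) = 0].
Proof.
move=> ls q0 r0; rewrite {}/rep {}/s'.
pose Inv n s' := let rep := arr s' aRep in
  [/\ forall i, i < m -> rep i < N /\ cl (rep i) = i,
      forall t, t < N -> arr s' aQ t = dft rep t,
      forall w, w < n -> dft rep (root (cl w)) -> ty w = ty (rep (cl w))
    & forall t, t < m -> root t = t -> ty (cen t) = 0 -> ty (rep t) = 0].
apply: (@for_inv N B Inv) => //.
  split=> //= [i im|t tN|t tm _]; rewrite ?r0 //; first exact: cen_cl.
  rewrite q0 //; rewrite /defect; congr (nat_of_bool (_ && odd (_ + _))).
  by apply: eq_bigr => i _; rewrite r0.
move=> n s' nN ag sn [I1 I2 I3 I4].
have ls' : lay s' by apply: (lay_agree ag).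
have cn := c_cl C nN; have tn := tree_lt nN; have tN := leq_trans tn m_le.
have [r1 r2] := I1 _ cn.
rewrite /When lrun_if [ev _ _]/= (lay_cl ls') (lay_root ls') sn I2 // eqb0 negbK.
case: ifP => dn; last first.
  split=> //= w; rewrite ltnS leq_eqVlt => /orP[/eqP ->|]; last exact: I3.
  by rewrite dn.
rewrite /Unless lrun_if eqEP !tyP /= ?(lay_cl ls') ?sn //; try exact: (lay_ctx ls').
case: eqP => [E|ne].
  split=> //= w; rewrite ltnS leq_eqVlt => /orP[/eqP ->|] //; exact: I3.
rewrite /= ?(lay_cl ls') ?(lay_root ls') ?sn /=.
set rep := arr s' aRep in I1 I2 I3 I4 r1 r2 dn ne *.
have DU t : t < N -> dft (fun j => if j == cl n then n else rep j) t = (t != root (cl n)) && dft rep t.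
  by move=> ht; apply: defect_upd.
have eta : upd rep (cl n) n = (fun j => if j == cl n then n else rep j) by [].
split=> /=.
- by move=> i im; rewrite eqnE; case: eqP => [->|_] //; apply: I1.
- move=> t ht; rewrite eqnE (DU t ht) I2 //; case: eqP => //=.
- move=> w wn; rewrite -/(upd rep (cl n) n) eta.
  have wN : w < N by lia.
  rewrite DU ?(leq_trans (tree_lt wN) m_le) // => /andP[nt dw].
  rewrite eqnE; case: eqP => [E|_]; first by rewrite E eqxx in nt.
  apply: I3 => //; move: wn; rewrite ltnS leq_eqVlt => /orP[/eqP E|//].
  by rewrite E eqxx in nt.
- move=> t tm rt t0; rewrite eqnE; case: eqP => [E|_]; last exact: I4.
  (* Swaps occur only in trees with constrained root, so an unconstrained root keeps its
     representative. *)
  by move: dn; rewrite /defect -E rt t0.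
Qed.

(** Opening an extra node clears the flag of its tree, so flag plus number of extra nodes remains
    equal to the defect; in particular a tree gets at most one. *)
Lemma extra_spec s (s' := run extra_cmd s) (e := arr s' aE) rep :
  lay s -> arr s aRep = rep -> (forall i, i < m -> rep i < N /\ cl (rep i) = i) ->
  (forall t, t < N -> arr s aQ t = dft rep t) ->
  (forall w, w < N -> arr s aE w = 0) ->
  [/\ forall t, t < N ->
        dft rep t = arr s' aQ t + \sum_(w < N) ((e w != 0) && (root (cl w) == t)) :> nat,
      forall w, w < N -> e w != 0 -> ty w = 1 /\ w <> rep (cl w),
      forall w, w < N -> arr s' aQ (root (cl w)) != 0 -> ty w = 1 -> w = rep (cl w)
    & var s' vCnt = m + \sum_(w < N) (e w != 0)].
Proof.
move=> ls hrep rep_cl q0 e0; rewrite {}/e {}/s' /extra_cmd lrun_seq.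
set s1 := run _ s; set body := When _ _.
pose Inv n s' := let e := arr s' aE in
  [/\ forall t, t < N ->
        dft rep t = arr s' aQ t + \sum_(w < n) ((e w != 0) && (root (cl w) == t)) :> nat,
      forall w, w < n -> e w != 0 -> ty w = 1 /\ w <> rep (cl w),
      forall w, w < n -> arr s' aQ (root (cl w)) != 0 -> ty w = 1 -> w = rep (cl w),
      var s' vCnt = m + \sum_(w < n) (e w != 0)
    & forall w, w < N -> n <= w -> e w = 0].
have ls1 : lay s1 by case: ls => [[]].
suff [? ? ? ? ?] : Inv N (run (LFor vA body) s1) by split.
apply: (@for_inv N B Inv) => //.
  split=> //= [t tN||w wN _]; last exact: e0.
    by rewrite big_ord0 addn0 q0.
  by rewrite big_ord0 addn0 (lay_m ls).
move=> n s' nN ag sn [I1 I2 I3 I4 I5].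
have ls' : lay s' by apply: (lay_agree ag).
have hrep' : arr s' aRep = rep by case: ag => _ ->.
have cn := c_cl C nN; have tn := tree_lt nN; have tN := leq_trans tn m_le.
have en := I5 n nN (leqnn _).
have keep s2 : var s2 vCnt = var s' vCnt -> arr s2 aE = arr s' aE -> arr s2 aQ = arr s' aQ ->
    (arr s' aQ (root (cl n)) != 0 -> ty n = 1 -> n = rep (cl n)) -> Inv n.+1 s2.
  move=> h1 h2 h3 h4; rewrite /Inv h1 h2 h3; split.
  - by move=> t ht; rewrite big_ord_recr /= en /= addn0; apply: I1.
  - move=> w; rewrite ltnS leq_eqVlt => /orP[/eqP ->|]; last exact: I2.
    by rewrite en.
  - by move=> w; rewrite ltnS leq_eqVlt => /orP[/eqP ->|] //; apply: I3.
  - by rewrite big_ord_recr /= en addn0.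
  - by move=> w wN nw; apply: I5 => //; apply: ltnW.
rewrite /body /When lrun_if [ev _ _]/= (lay_cl ls') (lay_root ls') sn.
case: ifP => qn; last by apply: keep => //; rewrite qn.
rewrite lrun_if eqEP tyP /= ?sn //; last exact: (lay_ctx ls').
case: (ty n =P 1) => [t1|t1]; last by apply: keep.
rewrite eqEP /= (lay_cl ls') sn hrep'.
case: (n =P rep (cl n)) => [nr|nr]; first by apply: keep.
have sumE (P : nat -> bool) : \sum_(w < n) (((if eqn w n then 1 else arr s' aE w) != 0) && P w)
    = \sum_(w < n) ((arr s' aE w != 0) && P w).
  by apply: eq_bigr => w _; rewrite eqnE (ltn_eqF (ltn_ord w)).
rewrite /= ?(lay_cl ls') ?(lay_root ls') ?sn; split=> /=.
- move=> t ht; rewrite big_ord_recr /= (sumE (fun w => root (cl w) == t)) !eqnE !eqxx /=.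
  have := I1 t ht; rewrite eq_sym; case: (root (cl n) =P t) => [<-|_]; last by rewrite addn0.
  by move: qn; move: (\sum_(w < n) _) (arr s' aQ _) => X Y; case: (dft _ _) => /=; lia.
- move=> w; rewrite eqnE; case: (w =P n) => [-> //|nw] wn h; apply: I2 h.
  by move: wn; rewrite ltnS leq_eqVlt => /orP[/eqP|].
- move=> w wn; rewrite eqnE; case: (root (cl w) =P _) => // nt h; apply: I3 h.
  by move: wn; rewrite ltnS leq_eqVlt => /orP[/eqP E|//]; case: nt; rewrite E.
- rewrite big_ord_recr /= eqnE eqxx /= I4 addnA; congr (m + _ + _).
  by apply: eq_bigr => w _; rewrite (ltn_eqF (ltn_ord w)).
- by move=> w wN nw; rewrite eqnE gtn_eqF //; apply: I5 => //; apply: ltnW.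
Qed.

Lemma flow_spec s (s' := run flow_cmd s) rep e :
  lay s -> arr s aRep = rep -> arr s aE = e ->
  (forall i, i < m -> rep i < N /\ cl (rep i) = i) ->
  (forall i, i < N -> arr s aF i = 0) -> forall i, i < m ->
  arr s' aF i = odd (\sum_(v < N) ((cl v == i) && (e v == 0)) + (ty (rep i) == 1)) :> nat.
Proof.
move=> ls hrep he rep_cl f0; rewrite {}/s' /flow_cmd lrun_seq.
set s1 := run _ s.
have A1 := lrun_agree N B (LFor vA load_body) s.
have ls1 : lay s1 by apply: (lay_agree A1).
have hrep1 : arr s1 aRep = rep by case: A1 => _ ->.
have f1 i : i < N -> arr s1 aF i = odd (\sum_(v < N) ((cl v == i) && (e v == 0))).
  move: i; pose Inv n s' := forall i, i < N ->
    arr s' aF i = odd (\sum_(v < n) ((cl v == i) && (e v == 0))).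
  apply: (@for_inv N B Inv) => //.
    by move=> i iN; rewrite /= f0 // big_ord0.
  move=> n s' nN ag sn I i iN.
  have ls' : lay s' by apply: (lay_agree ag).
  have he' : arr s' aE = e by case: ag => _ ->.
  have cN := leq_trans (c_cl C nN) m_le.
  rewrite big_ord_recr /load_body /When lrun_if eqEP /= he' sn.
  case: (e n =P 0) => en; last by rewrite /= andbF addn0 I.
  rewrite /= (lay_cl ls') ?sn eqnE andbT [i == _]eq_sym.
  case: (cl n =P i) => [<-|_]; last by rewrite addn0 I.
  by rewrite I // odd_succ addn1.
pose Inv n s' := forall i, i < N -> arr s' aF i =
  odd (\sum_(v < N) ((cl v == i) && (e v == 0)) + [&& i < n, i < m & ty (rep i) == 1]).
suff H : Inv N (run (LFor vA need_body) s1).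
  by move=> i im; have iN := leq_trans im m_le; rewrite H // iN im.
apply: (@for_inv N B Inv) => //.
  by move=> i iN; rewrite /= f1 // addn0.
move=> n s' nN ag sn I i iN.
have ls' : lay s' by apply: (lay_agree ag).
have hrep' : arr s' aRep = rep by case: ag => _ ->.
have skip : (i = n -> ~~ [&& n < m & ty (rep n) == 1]) ->
  [&& i < n.+1, i < m & ty (rep i) == 1] = [&& i < n, i < m & ty (rep i) == 1].
  case: (i =P n) => [-> /(_ erefl)|ne _]; first by rewrite ltnSn ltnn => /negbTE.
  by rewrite ltnS leq_eqVlt; case: eqP ne.
rewrite /need_body /When lrun_if ltEP /= sn (lay_m ls').
case: ltnP => nm; last by rewrite skip ?I // => _; rewrite ltnNge nm.
have [rn _] := rep_cl _ nm.
have rE : ev s' (LArr aRep (LVar vA)) = rep n by rewrite /= hrep' sn.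
rewrite eqEP tyP ?rE //; last exact: (lay_ctx ls').
case: (ty (rep n) =P 1) => /= t1; last first.
  by rewrite skip ?I // => _; rewrite negb_and; apply/orP; right; apply/eqP.
rewrite ?sn eqnE; case: (i =P n) => [->|ne]; last by rewrite skip ?I.
by rewrite ltnSn nm t1 eqxx I // ltnn addn0 odd_succ addn1.
Qed.

Lemma sum_odd_upd n (G f f' : nat -> nat) (a x : nat) : a < n ->
  (forall i, i < n -> odd (f' i) = odd (f i + (i == a) * x)) ->
  odd (\sum_(i < n) G i * f' i) = odd (\sum_(i < n) G i * f i + G a * x).
Proof.
move=> an h.
rewrite (@odd_sum n (fun i => G i * f' i) (fun i => G i * f i + (i == a) * (G i * x))).
  by rewrite big_split /= (sum_delta (fun i => G i * x) an).
move=> i hi; rewrite oddM h // !(oddD, oddM).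
by case: (odd (G i)); case: (odd (f i)); case: (odd x); case: (i == a).
Qed.

(* A defective cluster flips its parent, and parents have smaller indices, so *)
(* the downward loop leaves at each root the parity of the sum over its tree. *)
Lemma push_spec s (s' := run push_cmd s) (f := arr s aF) (f' := arr s' aF) :
  lay s -> (forall i, i < m -> f i <= 1) ->
  (forall j, j < m ->
     f' j = odd (f j + \sum_(i < m) ((par i == j) && (par i != i)) * f' i) :> nat) /\
  (forall t, t < m -> par t = t ->
     f' t = odd (\sum_(i < m) (root i == t) * f i) :> nat).
Proof.
move=> ls fb; rewrite {}/f' {}/s'.
(* After n rounds the clusters of index at least [N - n] have been pushed. The conserved quantity of
   a tree is the parity summed over the clusters not yet pushed and the root. *)
pose Inv n s' := let f' := arr s' aF in
  (forall j, j < m -> f' j = odd (f j +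
     \sum_(i < m) [&& N - n <= i, par i == j & par i != i] * f' i) :> nat) /\
  (forall t, t < m -> odd (\sum_(i < m) (root i == t) * f i) =
     odd (\sum_(i < m) ((root i == t) && ((i < N - n) || (par i == i))) * f' i)).
suff [H1 H2] : Inv N (run push_cmd s).
  rewrite /= subnn in H1 H2; split=> // t tm pt; rewrite H2 //.
  have rt : root t = t by case: (c_par C tm) => [[]|[]] //; rewrite pt ltnn.
  rewrite -[X in odd X](_ : (arr (run push_cmd s) aF t) = _); last first.
    rewrite -[LHS](sum_delta (arr (run push_cmd s) aF) tm); apply: eq_bigr => i _.
    congr (nat_of_bool _ * _); case: (val i =P t) => [->|ne]; first by rewrite rt pt !eqxx.
    apply/esym/negP => /andP[/eqP ri /eqP pi]; apply: ne.
    by case: (c_par C (ltn_ord i)) => [[_ h]|[h _ _]]; [rewrite -ri h | rewrite pi ltnn in h].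
  by rewrite (H1 t tm) oddb.
apply: (@for_inv N B Inv) => //.
  rewrite /Inv /= subn0; split=> [j jm|t tm].
    rewrite big1 ?addn0; last by move=> i _; rewrite leqNgt (leq_trans (ltn_ord i) m_le).
    by have := fb _ jm; rewrite -/f; case: (f j) => [|[]].
  congr odd; apply: eq_bigr => i _.
  by rewrite (leq_trans (ltn_ord i) m_le) andbT.
move=> n s' nN ag sn [I1 I2].
have ls' : lay s' by apply: (lay_agree ag).
set i0 := N - n.+1; have i0E : N - n = i0.+1 by rewrite /i0; lia.
have i0S : N - n.+1 = i0 by [].
rewrite i0E in I1 I2.
set s2 := setvar _ _ _; pose x := [&& i0 < m, par i0 != i0 & arr s' aF i0 != 0].
have f2 j : arr s2 aF j = if x && (j == par i0) then 1 - arr s' aF j else arr s' aF j.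
  rewrite /s2 lrun_seq; set s3 := run _ s'.
  have iE : var s3 vI = i0 by rewrite /= sn /i0; lia.
  have ls3 : lay s3 by apply: (lay_agree (lrun_agree N B (LSet vI (LOp OpSub (LOp OpSub LSize (LConst 1)) (LVar vA))) s')).
  have aF3 : arr s3 aF = arr s' aF by [].
  clearbody s3; rewrite /x -aF3.
  rewrite /When lrun_if ltEP /= iE (lay_m ls3); case: ltnP => //= im.
  rewrite eqEP /= iE (lay_par ls3); case: eqP => //= pi.
  case: (arr s3 aF i0 =P 0) => //= fi.
  by rewrite ?iE ?(lay_par ls3) eqnE; case: (j =P _) => [->|].
clearbody s2; rewrite /Inv -/i0.
have fle j : j < m -> arr s' aF j <= 1 by move=> jm; rewrite I1 //; case: (odd _).
case: (ltnP i0 m) => im; last first.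
  have same j : arr s2 aF j = arr s' aF j by rewrite f2 /x ltnNge im.
  split=> [j jm|t tm].
    rewrite same I1 //; congr (nat_of_bool (odd (_ + _))); apply: eq_bigr => i _; rewrite same.
    have hi := ltn_ord i; have -> : (i0 < i) = false by lia.
    by have -> : (i0 <= i) = false by lia.
  rewrite I2 //; congr odd; apply: eq_bigr => i _; rewrite same.
  have hi := ltn_ord i; have -> : (i < i0.+1) = true by lia.
  by have -> : (i < i0) = true by lia.
case: (par i0 =P i0) => pi.
  have same j : arr s2 aF j = arr s' aF j by rewrite f2 /x pi eqxx andbF.
  split=> [j jm|t tm].
    rewrite same I1 //; congr (nat_of_bool (odd (_ + _))); apply: eq_bigr => i _; rewrite same.
    congr (nat_of_bool _ * _); rewrite [i0 <= i]leq_eqVlt.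
    by case: (i0 =P i) => [<-|//]; rewrite pi eqxx !andbF.
  rewrite I2 //; congr odd; apply: eq_bigr => i _; rewrite same.
  congr (nat_of_bool (_ && _) * _); rewrite ltnS leq_eqVlt.
  by case: (nat_of_ord i =P i0) => [->|//]; rewrite pi eqxx !orbT.
have [[//]|[pl rp _]] := c_par C im.
have pm : par i0 < m by apply: ltn_trans im.
have f2o j : j < m -> odd (arr s2 aF j) = odd (arr s' aF j + (j == par i0) * arr s' aF i0).
  move=> jm; rewrite f2 /x im; move/eqP: (pi) => -> /=.
  have := fle _ jm; have := fle _ im.
  by case: (j == par i0); case: (arr s' aF i0) => [|[|]] //; case: (arr s' aF j) => [|[|]].
have f2le j : j < m -> arr s2 aF j <= 1.
  by move=> jm; rewrite f2; have := fle _ jm; case: ifP => // _; lia.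
(* A push only alters the parent, of smaller index, so values already pushed are final. *)
have f2ge j : i0 <= j -> arr s2 aF j = arr s' aF j.
  by move=> h; rewrite f2 (gtn_eqF (leq_trans pl h)) andbF.
have nb y : y <= 1 -> y = odd y by case: y => [|[]].
split=> [j jm|t tm].
  rewrite [LHS](nb _ (f2le _ jm)) f2o // I1 // oddD oddb oddM oddb.
  congr nat_of_bool; rewrite [in RHS]oddD [odd (f j + _)]oddD -addbA; congr (_ (+) _).
  have -> : \sum_(i < m) [&& i0 <= i, par i == j & par i != i] * arr s2 aF i =
     \sum_(i < m) [&& i0 < i, par i == j & par i != i] * arr s' aF i +
     (j == par i0) * arr s' aF i0.
    rewrite -[X in _ = _ + X](sum_delta (fun i => (j == par i) * arr s' aF i) im) -big_split /=.
    apply: eq_bigr => i _; rewrite [i0 <= i]leq_eqVlt [i0 == i]eq_sym.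
    case: (nat_of_ord i =P i0) => [->|_] /=.
      by rewrite ltnn mul0n add0n mul1n f2ge // [j == _]eq_sym; move/eqP: (pi) => ->; rewrite andbT.
    case: (ltnP i0 i) => h /=; last by rewrite mul0n addn0.
    by rewrite mul0n addn0 f2ge // ltnW.
  by rewrite oddD oddM oddb.
rewrite I2 //.
rewrite (@sum_odd_upd m (fun i => (root i == t) && ((i < i0) || (par i == i))) (arr s' aF) (arr s2 aF) (par i0) (arr s' aF i0)) //.
rewrite pl rp andbT; congr odd.
rewrite -[X in _ = _ + X](sum_delta (fun i => (root i == t) * arr s' aF i) im) -big_split /=.
apply: eq_bigr => i _; rewrite ltnS leq_eqVlt.
case: (nat_of_ord i =P i0) => [->|_] /=; last by rewrite mul0n addn0.
by rewrite ltnn andbT; case: (par i0 =P i0) => //; rewrite andbF mul0n mul1n.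
Qed.

Lemma assign_spec s (s' := run assign_cmd s) rep e f :
  lay s -> arr s aRep = rep -> arr s aE = e -> arr s aF = f ->
  (forall i, i < m -> rep i < N /\ cl (rep i) = i) ->
  (forall v, v < N -> arr s aS v = 0) -> forall v, v < N ->
  arr s' aSg v = sigma cl par rep e f v /\
  arr s' aS v = (e v != 0) || (v == rep (cl v)) :> nat.
Proof.
move=> ls hrep he hf rep_cl S0; rewrite {}/s' /assign_cmd lrun_seq.
set s1 := run _ s.
have A1 := lrun_agree N B (LFor vA assign_body) s.
have ls1 : lay s1 by apply: (lay_agree A1).
have hrep1 : arr s1 aRep = rep by case: A1 => _ ->.
pose Inv n s' := forall v, v < N ->
  (v < n -> arr s' aSg v = sigma cl par rep e f v) /\
  arr s' aS v = (v < n) && (e v != 0) :> nat.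
have I1 : Inv N s1.
  apply: (@for_inv N B Inv) => //.
    by move=> v vN; rewrite /= S0.
  move=> n s' nN ag sn I v vN.
  have ls' : lay s' by apply: (lay_agree ag).
  have he' : arr s' aE = e by case: ag => _ ->.
  have hf' : arr s' aF = f by case: ag => _ ->.
  have hrep' : arr s' aRep = rep by case: ag => _ ->.
  have [Ia Ib] := I v vN; have [_ Ibn] := I n nN; rewrite ltnn /= in Ibn.
  set s2 := setvar _ _ _.
  have [E1 E2] : arr s2 aSg v = (if v == n then sigma cl par rep e f n else arr s' aSg v) /\
      arr s2 aS v = (if (v == n) && (e n != 0) then 1 else arr s' aS v).
    rewrite /s2 /assign_body lrun_if [ev _ _]/= sn he' /sigma.
    case: ifP => en; first by rewrite /= sn !eqnE andbT.
    rewrite lrun_seq andbF; set s3 := run _ s'.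
    have -> : arr s' aS = arr s3 aS by [].
    have -> : (if v == n then if moved cl par rep f n then rep (par (cl n)) else rep (cl n) else arr s' aSg v) =
      (if (v == n) && moved cl par rep f n then rep (par (cl n)) else arr s3 aSg v).
      rewrite /s3 /= sn (lay_cl ls') hrep' eqnE; case: eqP => //= _.
    have ls3 : lay s3 by case: ls' => [[]].
    have sn3 : var s3 vA = n by [].
    have hrep3 : arr s3 aRep = rep by [].
    have hf3 : arr s3 aF = f by [].
    clearbody s3.
    rewrite /When /Unless lrun_if eqEP /= sn3 (lay_cl ls3) hrep3 /moved.
    case: (n =P rep (cl n)) => /= _; last by rewrite andbF.
    rewrite eqEP /= (lay_par ls3) (lay_cl ls3) sn3; case: (par (cl n) =P cl n) => /= _; first by rewrite andbF.
    rewrite ?(lay_cl ls3) ?sn3 hf3; case: (f (cl n) =P 0) => /= _; first by rewrite andbF.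
    by rewrite andbT ?(lay_par ls3) ?(lay_cl ls3) ?sn3 ?hrep3 eqnE.
  rewrite E1 E2 ltnS leq_eqVlt; case: (v =P n) => [->|_] //=; split=> //.
  by case: (e n =P 0) => //=; rewrite Ibn.
pose Inv2 n s' := (forall v, arr s' aSg v = arr s1 aSg v) /\ forall v, v < N ->
  arr s' aS v = (e v != 0) || ((v == rep (cl v)) && (cl v < n)) :> nat.
have [H1 H2] : Inv2 N (run (LFor vA open_body) s1).
  apply: (@for_inv N B Inv2) => //.
    by split=> // v vN; have [_ /= ->] := I1 v vN; rewrite vN andbF orbF.
  move=> n s' nN ag sn [Ja Jb].
  have ls' : lay s' by apply: (lay_agree ag).
  have hrep' : arr s' aRep = rep by case: ag => _ ->.
  rewrite /Inv2 /open_body /When lrun_if ltEP [ev _ _]/= [ev _ (LVar vM)]/= sn (lay_m ls').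
  case: ltnP => nm.
    split=> //= v vN; rewrite sn hrep' eqnE; case: (v =P rep n) => [->|ne].
      by have [_ ->] := rep_cl _ nm; rewrite eqxx ltnSn orbT.
    rewrite Jb //; congr (nat_of_bool (_ || _)); case: (v =P rep (cl v)) => // E.
    by rewrite /= [cl v < n.+1]ltnS [cl v <= n]leq_eqVlt; case: (cl v =P n) => // Ec; case: ne; rewrite E Ec.
  split=> //= v vN; rewrite Jb //; congr (nat_of_bool (_ || (_ && _))).
  by have h := leq_trans (c_cl C vN) nm; rewrite h (leq_trans h (leqnSn _)).
move=> v vN; have [h _] := I1 v vN; rewrite H1 h // H2 //; split=> //.
by rewrite (leq_trans (c_cl C vN) m_le) andbT.
Qed.

Lemma check_spec s (s' := run check_cmd s) : inp s = xs ->
  (var s' vOk != 0) <-> (forall t, t < N -> arr s aQ t = 0) /\ var s vCnt <= k.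
Proof.
move=> hi; rewrite {}/s' /check_cmd lrun_seq lrun_seq; set s1 := run _ s; set s2 := run _ s1.
pose Inv n s' := (var s' vOk != 0) <-> (forall t, t < n -> arr s aQ t = 0).
have I2 : Inv N s2.
  apply: (@for_inv N B Inv) => // n s' nN ag sn I.
  have qE : arr s' aQ = arr s aQ by case: ag => _ ->.
  rewrite /Inv /When lrun_if [ev _ _]/= sn qE.
  case: (arr s aQ n =P 0) => /= qn.
    split=> [/I h t|h]; last by apply/I => t tn; apply: h; apply: ltnW.
    by rewrite ltnS leq_eqVlt => /orP[/eqP ->|/h].
  by split=> // /(_ n (ltnSn _)).
have [fv _ fi] := lrun_agree N B (LFor vA (When (LArr aQ (LVar vA)) (LSet vOk (LConst 0)))) s1.
have cE : var s2 vCnt = var s vCnt by rewrite /s2 fv.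
have iE : inp s2 = xs by rewrite /s2 fi.
have kEv : ev s2 kE = k by rewrite /kE /= iE.
rewrite /When lrun_if ltEP kEv [ev _ _]/= cE.
case: (ltnP k (var s vCnt)) => h /=; last by split=> [/I2|[/I2]].
by split=> // -[_].
Qed.

(** The first half applies the feasibility lemmas to the computed arrays, the second applies the
    lower bound to an arbitrary solution of radius r: no flag can survive, and the number of opened
    nodes is at most k. *)
Lemma repair_spec s (s' := run repair_cmd s) :
  lay s ->
  (forall i, i < N -> arr s aQ i = 0) -> (forall i, i < N -> arr s aE i = 0) ->
  (forall i, i < N -> arr s aF i = 0 /\ arr s aS i = 0) ->
  (var s' vOk != 0 -> valid (7%:R * D u0 v0)%R (arr s' aS) (arr s' aSg)) /\
  (forall S sg, valid (D u0 v0) S sg -> var s' vOk != 0).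
Proof.
move=> l0 q0 e0 fs0; rewrite {}/s' /repair_cmd.
rewrite !(lrun_seq N B _ _ _).
set s1 := run parity_cmd s; set s2 := run swap_cmd s1; set s3 := run extra_cmd s2.
set s4 := run flow_cmd s3; set s5 := run push_cmd s4; set s6 := run assign_cmd s5.
set s7 := run check_cmd s6.
have l1 : lay s1 by apply: (lay_agree (lrun_agree N B parity_cmd s)).
have l2 : lay s2 by apply: (lay_agree (lrun_agree N B swap_cmd s1)).
have l3 : lay s3 by apply: (lay_agree (lrun_agree N B extra_cmd s2)).
have l4 : lay s4 by apply: (lay_agree (lrun_agree N B flow_cmd s3)).
have l5 : lay s5 by apply: (lay_agree (lrun_agree N B push_cmd s4)).
have l6 : lay s6 by apply: (lay_agree (lrun_agree N B assign_cmd s5)).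
have [q1 r1] := parity_spec l0 q0.
have [rep_cl q2 same rep_root] := swap_spec l1 q1 r1.
have e2 w : w < N -> arr s2 aE w = 0.
  by move=> wN; rewrite /s2 frame_arr // /s1 frame_arr // e0.
have := extra_spec l2 erefl rep_cl q2 e2; rewrite -/s3.
set rep := arr s2 aRep in rep_cl q2 same rep_root *; set e := arr s3 aE.
move=> [x1 x2 x3 x4].
have rep3 : arr s3 aRep = rep by rewrite /s3 frame_arr.
have f3 i : i < N -> arr s3 aF i = 0.
  by move=> iN; rewrite /s3 frame_arr // /s2 frame_arr // /s1 frame_arr //; case: (fs0 i iN).
have f4 := flow_spec l3 rep3 erefl rep_cl f3; rewrite -/s4 in f4.
have f4b i : i < m -> arr s4 aF i <= 1 by move/f4 => ->; case: (odd _).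
have [p1 p2] := push_spec l4 f4b; rewrite -/s5 in p1 p2.
have rep5 : arr s5 aRep = rep by rewrite /s5 frame_arr // /s4 frame_arr.
have e5 : arr s5 aE = e by rewrite /s5 frame_arr // /s4 frame_arr.
have S5 v : v < N -> arr s5 aS v = 0.
  move=> vN; rewrite /s5 frame_arr // /s4 frame_arr // /s3 frame_arr // /s2 frame_arr //.
  by rewrite /s1 frame_arr //; case: (fs0 v vN).
have a6 := assign_spec l5 rep5 e5 erefl rep_cl S5; rewrite -/s6 in a6.
have i6 : inp s6 = xs by case: (lay_ctx l6).
have ok := check_spec i6; rewrite -/s7 in ok.
have q6 : arr s6 aQ = arr s3 aQ.
  by rewrite /s6 frame_arr // /s5 frame_arr // /s4 frame_arr.
have c6 : var s6 vCnt = var s3 vCnt.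
  by rewrite /s6 frame_var // /s5 frame_var // /s4 frame_var.
rewrite q6 c6 x4 in ok.
have S7 : arr s7 aS = arr s6 aS by rewrite /s7 frame_arr.
have Sg7 : arr s7 aSg = arr s6 aSg by rewrite /s7 frame_arr.
split=> [/ok [Q0 card]|S sg V].
  have balanced t : t < N ->
     dft rep t = \sum_(w < N) ((e w != 0) && (root (cl w) == t)) :> nat.
    by move=> tN; rewrite x1 // Q0.
  rewrite S7 Sg7; set f1 := arr s5 aF in p1 p2 a6.
  have sumE u : \sum_(v < N) (arr s6 aSg v == u) = \sum_(v < N) (sigma cl par rep e f1 v == u).
    by apply: eq_bigr => v _; have [-> _] := a6 v (ltn_ord v).
  split.
  - apply: leq_trans card.
    rewrite addnC -[m in X in _ <= X](card_ord m) -sum1_card.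
    rewrite -(@sum_section N m cl rep (fun=> 1) (c_cl C) rep_cl) -big_split /=.
    apply: leq_sum => v _; have [_ ->] := a6 v (ltn_ord v).
    by rewrite muln1; case: (e v != 0); case: (_ == _).
  - by move=> u uN; have [_ ->] := a6 u uN; case: (_ || _).
  - move=> v vN; have [-> _] := a6 v vN.
    have sN := sigma_lt C rep_cl e f1 vN; split=> //.
    have [_ ->] := a6 _ sN; case: (sigma_center C rep e f1 vN) => [-> //|[i im ->]].
    by have [_ ->] := rep_cl _ im; rewrite eqxx orbT.
  - move=> u uN; rewrite sumE; have [_ ->] := a6 u uN.
    case: (e u =P 0) => /= [_|/eqP eu].
      case: (u =P rep (cl u)) => // E _ tu.
      rewrite E; apply: (sigma_parity C rep_cl rep_root x2 balanced f4 p1 p2) => //.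
        exact: (c_cl C).
      by rewrite -E.
    by rewrite (sigma_extra C rep_cl f1 x2 uN eu); have [-> _] := x2 u uN eu.
  - move=> v vN; have [-> _] := a6 v vN.
    exact: (sigma_dist dl_refl dl_sym dl_tri C rep_cl e f1 vN).
apply/ok.
have sg_lt v : v < N -> sg v < N by move=> vN; case: (valid_center V vN).
have sg_S v : v < N -> S (sg v) != 0 by move=> vN; case: (valid_center V vN).
have sg_dl v : v < N -> dl 1 v (sg v).
  by move=> vN; rewrite /dl GRing.mul1r D_sym // ?sg_lt // (valid_dist V).
have par_ok u : u < N -> S u != 0 -> ty u != 0 -> odd (\sum_(v < N) (sg v == u)) = (ty u == 1).
  exact: (valid_parity V).
split.
  (* A flag left standing means a defective tree in which every odd node is a representative, which
     [defect_extra] rules out. *)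
  move=> t tN; apply/eqP; apply/negPn/negP => qt.
  have dt : dft rep t.
    by have := x1 t tN; case: (dft rep t) => //; move: qt; lia.
  apply: (defect_extra dl_sym C sg_lt sg_S sg_dl par_ok same dt) => w wN rw.
  by apply: x3 => //; rewrite rw.
have := centers_ge dl_sym C rep_cl sg_lt sg_S sg_dl par_ok same.
have cardS : \sum_(u < N) (S u != 0) <= k.
  apply: leq_trans (valid_card V); apply: leq_sum => u _.
  by case: (S u).
move=> h; apply: leq_trans cardS; apply: leq_trans h; rewrite leq_add2l.
rewrite (@sum_fiber N N (root \o cl) (fun w => e w != 0)); last first.
  by move=> v vN; apply: leq_trans (tree_lt vN) m_le.
apply: leq_sum => t _; rewrite x1 //; apply: leq_trans (leq_addl _ _).
by apply: leq_sum => w _ /=; rewrite mulnb andbC.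
Qed.

End Tree.

Lemma attempt_spec s (s' := run attempt_cmd s) : ctx s ->
  (var s' vOk != 0 -> valid (7%:R * D u0 v0)%R (arr s' aS) (arr s' aSg)) /\
  (forall S sg, valid (D u0 v0) S sg -> var s' vOk != 0).
Proof.
move=> cs; rewrite {}/s' /attempt_cmd lrun_seq lrun_seq.
set s1 := run init_cmd s; set s2 := run greedy_cmd s1.
have [m0 c0 q0 e0 fs0] := init_spec s; rewrite -/s1 in m0 c0 q0 e0 fs0.
have cs1 : ctx s1 by apply: (ctx_agree (lrun_agree N B init_cmd s)).
have cs2 : ctx s2 by apply: (ctx_agree (lrun_agree N B greedy_cmd s1)).
have C := greedy_spec cs1 m0 c0; rewrite -/s2 in C.
apply: (repair_spec C) => [|i iN|i iN|i iN].
- by split.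
- by rewrite /s2 frame_arr // q0.
- by rewrite /s2 frame_arr // e0.
- rewrite /s2 (@frame_arr N B greedy_cmd aF) // (@frame_arr N B greedy_cmd aS) //.
  exact: fs0.
Qed.

End Attempt.

(** * Search over all guesses of the radius *)

Lemma valid_eq R S sg S' sg' : (forall v, v < N -> S v = S' v) ->
  (forall v, v < N -> sg v = sg' v) -> valid R S sg -> valid R S' sg'.
Proof.
move=> hS hg [v1 v2 v3 v4 v5]; split.
- by apply: leq_trans v1; apply: leq_sum => u _; rewrite hS.
- by move=> u uN; rewrite -hS // v2.
- by move=> v vN; have [h1 h2] := v3 v vN; rewrite -hg // -hS.
- move=> u uN; rewrite -hS // => h1 h2; rewrite -v4 //; congr odd.
  by apply: eq_bigr => v _; rewrite hg.
- by move=> v vN; rewrite -hg // v5.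
Qed.

Lemma copy_spec s (s' := run (LFor vA copy_body) s) v : v < N ->
  arr s' aBS v = arr s aS v /\ arr s' aBSg v = arr s aSg v.
Proof.
rewrite {}/s'; move: v.
apply: (@for_inv N B (fun n s' => forall v, v < n ->
  arr s' aBS v = arr s aS v /\ arr s' aBSg v = arr s aSg v)) => //.
move=> n s' nN [_ fa _] sn I v; rewrite ltnS leq_eqVlt /= sn !eqnE.
rewrite (fa aS) // (fa aSg) //.
by case: (v =P n) => [-> //|_ /= h]; apply: I.
Qed.

(** [P] is the set of guesses tried so far. The saved guess is compared only with tried guesses that
    admit a solution; it may itself lie below the optimum, which does no harm. *)
Record best (P : nat -> nat -> Prop) s : Prop := Best {
  best_inp : inp s = xs;
  best_sound : var s vHave != 0 -> [/\ var s vBU < N, var s vBV < N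
    & valid (7%:R * D (var s vBU) (var s vBV))%R (arr s aBS) (arr s aBSg)];
  best_min : forall u v S sg, P u v -> u < N -> v < N -> valid (D u v) S sg ->
    var s vHave != 0 /\ (D (var s vBU) (var s vBV) <= D u v)%R }.

Lemma best_weaken (P P' : nat -> nat -> Prop) s :
  (forall u v, u < N -> v < N -> P' u v -> P u v) -> best P s -> best P' s.
Proof.
move=> h [h1 h2 h3]; split=> // u v S sg p uN vN; exact: h3 (h _ _ uN vN p) uN vN.
Qed.

Lemma best_set P s x y : x \in [:: vU; vV; vA] -> best P s -> best P (setvar s x y).
Proof.
by rewrite !inE => /or3P[] /eqP -> [h1 h2 h3]; split.
Qed.

Lemma try_spec P s u0 v0 : u0 < N -> v0 < N -> var s vU = u0 -> var s vV = v0 ->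
  best P s -> best (fun u v => P u v \/ u = u0 /\ v = v0) (run try_cmd s).
Proof.
move=> uN vN hU hV [b1 b2 b3]; rewrite /try_cmd lrun_seq; set s1 := run attempt_cmd s.
have A1 := lrun_agree N B attempt_cmd s.
have cs : ctx u0 v0 s by split.
have cs1 : ctx u0 v0 s1 by apply: (ctx_agree A1).
have [sound complete] := attempt_spec uN vN cs; rewrite -/s1 in sound complete.
have hE : var s1 vHave = var s vHave by rewrite /s1 frame_var.
have uE : var s1 vBU = var s vBU by rewrite /s1 frame_var.
have vE : var s1 vBV = var s vBV by rewrite /s1 frame_var.
have BE : arr s1 aBS = arr s aBS by rewrite /s1 frame_arr.
have BgE : arr s1 aBSg = arr s aBSg by rewrite /s1 frame_arr.
have iE : inp s1 = xs by case: cs1.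
clearbody s1.
rewrite /save_cmd /When lrun_if [ev _ _]/=; case: ifP => ok; last first.
  split; rewrite ?hE ?uE ?vE ?BE ?BgE // => u v S sg [|[-> ->]]; first exact: b3.
  by move=> _ _ /complete; rewrite ok.
have V := sound ok.
rewrite /Unless lrun_if.
have -> : (ev s1 (LOp OpMul (LVar vHave) (within 1 (LVar vBU) (LVar vBV))) != 0) =
   (var s vHave != 0) && (D (var s vBU) (var s vBV) <= D u0 v0)%R.
  rewrite [ev _ _]/= muln_eq0 negb_or hE; case: eqP => //= /eqP h.
  have [h1 h2 _] := b2 h.
  by rewrite (withinP (u0 := u0) (v0 := v0)) //= ?uE ?vE // /dl GRing.mul1r.
case: ifP => [/andP[h1 h2]|h].
  split; rewrite ?hE ?uE ?vE ?BE ?BgE // => u v S sg [|[-> ->]]; first exact: b3.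
  by [].
rewrite lrun_seq; set s2 := run _ s1; set s3 := run _ s2.
have A3 := lrun_agree N B (LFor vA copy_body) s2; case: (A3) => fv fa fi.
have c3 := copy_spec s2; rewrite -/s3 in c3.
have [hU1 hV1] : var s1 vU = u0 /\ var s1 vV = v0 by case: cs1.
have h3 : var s3 vHave = 1 by rewrite /s3 fv.
have u3 : var s3 vBU = u0 by rewrite /s3 fv //= hU1.
have v3 : var s3 vBV = v0 by rewrite /s3 fv //= hV1.
split; rewrite ?h3 ?u3 ?v3.
- by rewrite /s3 fi.
- move=> _; split=> //; by apply: valid_eq V => w wN; have [h5 h6] := c3 w wN; rewrite ?h5 ?h6.
- move=> u v S sg [h1 h2 h4 h5|[-> ->]] //; split=> //.
  have [g1 g2] := b3 _ _ _ _ h1 h2 h4 h5.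
  apply: Order.POrderTheory.le_trans g2.
  by move/negbT: h; rewrite g1 /= -Order.TotalTheory.ltNge => /Order.POrderTheory.ltW.
Qed.

Lemma search_spec s : inp s = xs -> var s vHave = 0 ->
  best (fun _ _ => True) (run (LFor vU (LFor vV try_cmd)) s).
Proof.
move=> hi h0.
pose Inv n s' := best (fun u _ => u < n) s'.
apply: (@best_weaken (fun u _ => u < N)) => //.
apply: (@for_inv N B Inv) => //.
  by split=> //=; rewrite h0.
move=> n s' nN ag sn I; apply: best_set => //.
apply: (@best_weaken (fun u v => u < n \/ u = n /\ v < N)).
  by move=> u v _ vN; rewrite ltnS leq_eqVlt => /orP[/eqP ->|]; [right | left].
pose Inv2 j s' := best (fun u v => u < n \/ u = n /\ v < j) s'.
apply: (@for_inv N B Inv2) => //.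
  by apply: best_set => //; apply: best_weaken I => u v _ _ [//|[]].
move=> j s2 jN [fv _ _] sj I2; apply: best_set => //.
have hn : var s2 vU = n by rewrite fv.
apply: best_weaken (try_spec nN jN hn sj I2) => u v _ _ [h|[-> h]]; first by left; left.
move: h; rewrite ltnS leq_eqVlt => /orP[/eqP ->|h]; first by right.
by left; right.
Qed.

(** The input has at least [N + N] cells, so that writing the answer is not affected by the clamping
    of addresses. *)
Lemma main_spec s (s' := run main_cmd s) : N + N <= B ->
  inp s = xs -> var s vHave = 0 ->
  (exists u v S sg, [/\ u < N, v < N & valid (D u v) S sg]) ->
  exists u v, [/\ u < N, v < N,
     valid (7%:R * D u v)%R (inp s') (fun w => inp s' (N + w))
   & forall u' v' S sg, u' < N -> v' < N -> valid (D u' v') S sg -> (D u v <= D u' v')%R].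
Proof.
move=> NB hi h0 [u [v [S [sg [uN vN V]]]]].
rewrite {}/s' /main_cmd lrun_seq; set s1 := run _ s.
have [b1 b2 b3] := search_spec hi h0; rewrite -/s1 in b1 b2 b3.
have [have1 _] := b3 _ _ _ _ I uN vN V; have [h1 h2 h3] := b2 have1.
exists (var s1 vBU), (var s1 vBV); split=> // [|u' v' S' sg' h4 h5 h6]; last first.
  by have [] := b3 _ _ _ _ I h4 h5 h6.
suff H w : w < N -> arr s1 aBS w = inp (run (LFor vA output_body) s1) w /\
    arr s1 aBSg w = inp (run (LFor vA output_body) s1) (N + w).
  by apply: valid_eq h3 => w /H [].
move: w; apply: (@for_inv N B (fun n s' => forall w, w < n ->
  arr s1 aBS w = inp s' w /\ arr s1 aBSg w = inp s' (N + w))) => //.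
move=> n s' nN [_ fa _] sn IH w; rewrite ltnS leq_eqVlt /= sn !fa // !eqnE.
have -> : minn n B = n by apply/minn_idPl; lia.
have -> : minn (N + n) B = N + n by apply/minn_idPl; lia.
rewrite eqn_add2l; case: (w =P n) => [->|ne] /= hw.
  by have -> : (n == N + n) = false by lia.
have -> : (w == N + n) = false by lia.
have -> : (N + w == n) = false by lia.
exact: IH.
Qed.

End Spec.

(** * Instances *)

Lemma nth_flatten_const (T : Type) (x0 : T) (ss : seq (seq T)) c i j :
  (forall k, k < size ss -> size (nth [::] ss k) = c) -> i < size ss -> j < c ->
  nth x0 (flatten ss) (c * i + j) = nth x0 (nth [::] ss i) j.
Proof.
elim: ss i => [|s ss IH] [|i] //= h hi hj.
  by rewrite muln0 add0n nth_cat (h 0) // hj.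
rewrite nth_cat (h 0) // mulnS -addnA ltnNge leq_addr /= addKn.
by apply: IH => // k hk; apply: (h k.+1).
Qed.

Lemma size_flatten_const (T : Type) (ss : seq (seq T)) c :
  (forall k, k < size ss -> size (nth [::] ss k) = c) ->
  size (flatten ss) = c * size ss.
Proof.
elim: ss => [|s ss IH] /= h; first by rewrite muln0.
by rewrite size_cat (h 0) // IH ?mulnS // => k hk; apply: (h k.+1).
Qed.

Section Instance.
Variable I : instance.
Local Notation n := (num_nodes I).
Local Notation xs := (encode_instance I).

Definition node_type (v : nat) : nat :=
  if insub v is Some i then encode_parity (@constraint I i) else 0.

Definition node_dist (u v : nat) : rat :=
  match insub u, insub v with
  | Some i, Some j => @dist I i j
  | _, _ => 0%R
  end.

Lemma node_typeE (i : 'I_n) : node_type i = encode_parity (constraint i).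
Proof. by rewrite /node_type valK. Qed.

Lemma node_distE (i j : 'I_n) : node_dist i j = dist i j.
Proof. by rewrite /node_dist !valK. Qed.

Lemma nth_enum_ord_map (T : Type) (x0 : T) (f : 'I_n -> T) (i : 'I_n) :
  nth x0 [seq f v | v <- enum 'I_n] i = f i.
Proof. by rewrite (nth_map i) ?size_enum_ord // nth_ord_enum. Qed.

Definition rows := [seq [seq encode_rat (dist u v) | v <- enum 'I_n] | u <- enum 'I_n].

Lemma encode_instanceE : xs =
  [:: n; max_centers I] ++ [seq encode_parity (constraint v) | v <- enum 'I_n]
    ++ flatten (flatten rows).
Proof. by []. Qed.

Lemma size_row k : k < size rows -> size (nth [::] rows k) = n.
Proof.
rewrite size_map size_enum_ord => kn.
by rewrite (nth_enum_ord_map [::] _ (Ordinal kn)) size_map size_enum_ord.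
Qed.

Lemma size_rows : size rows = n.
Proof. by rewrite size_map size_enum_ord. Qed.

Lemma size_cells : size (flatten rows) = n * n.
Proof. by rewrite (size_flatten_const size_row) size_rows. Qed.

Lemma nth_cell (i j : 'I_n) : nth [::] (flatten rows) (i * n + j) = encode_rat (dist i j).
Proof.
rewrite mulnC (nth_flatten_const _ size_row) ?size_rows //.
by rewrite (nth_enum_ord_map [::] _ i) nth_enum_ord_map.
Qed.

Lemma size_cell k : k < size (flatten rows) -> size (nth [::] (flatten rows) k) = 2.
Proof.
rewrite size_cells => h.
have n0 : 0 < n by case: (posnP n) h => // ->.
have hi : k %/ n < n by rewrite ltn_divLR.
have hj : k %% n < n by rewrite ltn_mod.
have := nth_cell (Ordinal hi) (Ordinal hj); rewrite /= -divn_eq => -> //.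
Qed.

Lemma size_encode : size xs = 2 + n + 2 * (n * n).
Proof.
rewrite encode_instanceE !size_cat size_map size_enum_ord.
by rewrite (size_flatten_const size_cell) size_cells addnA.
Qed.

Lemma nth_minn a : nth 0 xs (minn a (size xs)) = nth 0 xs a.
Proof.
case: (leqP a (size xs)) => h; first by [].
by rewrite !nth_default // ltnW.
Qed.

Lemma nth_type (i : 'I_n) : nth 0 xs (2 + i) = node_type i.
Proof.
rewrite -[LHS]/(nth 0 (_ ++ flatten (flatten rows)) i).
rewrite nth_cat size_map size_enum_ord ltn_ord.
by rewrite nth_enum_ord_map node_typeE.
Qed.

Lemma nth_dist (i j : 'I_n) b : b < 2 ->
  nth 0 xs (2 + n + 2 * (i * n + j) + b) = nth 0 (encode_rat (dist i j)) b.
Proof.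
move=> b2; rewrite -(addnA (2 + n)) -(addnA 2).
rewrite -[LHS]/(nth 0 (_ ++ flatten (flatten rows)) (n + (2 * (i * n + j) + b))).
rewrite nth_cat size_map size_enum_ord ltnNge leq_addr /= addKn.
rewrite (nth_flatten_const _ size_cell) ?nth_cell // size_cells.
have := ltn_ord i; have := ltn_ord j; nia.
Qed.

(** * Translation between solutions and number-indexed vectors *)

Definition set_vec (s : solution I) (u : nat) : nat :=
  if insub u is Some i then nat_of_bool (i \in centers s) else 0.

Definition map_vec (s : solution I) (u : nat) : nat :=
  if insub u is Some i then nat_of_ord (assignment s i) else 0.

Lemma set_vecE s (i : 'I_n) : set_vec s i = (i \in centers s).
Proof. by rewrite /set_vec valK. Qed.

Lemma map_vecE s (i : 'I_n) : map_vec s i = assignment s i.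
Proof. by rewrite /map_vec valK. Qed.

Local Notation ok := (valid n (max_centers I) node_type node_dist).

Lemma feasible_valid s (R : rat) : feasible s -> (objective s <= R)%R ->
  ok R (set_vec s) (map_vec s).
Proof.
case=> h1 h2 h3 hR; split.
- rewrite (leq_trans _ h1) // -sum1_card [X in _ <= X]big_mkcond /=.
  by apply: leq_sum => i _; rewrite set_vecE; case: (_ \in _).
- by move=> u un; rewrite (set_vecE s (Ordinal un)); case: (_ \in _).
- move=> v vn; rewrite (map_vecE s (Ordinal vn)); split=> //.
  by rewrite set_vecE h2.
- move=> u un; rewrite (set_vecE s (Ordinal un)) (node_typeE (Ordinal un)) eqb0 negbK.
  move=> hu; have := h3 _ hu.
  have -> : \sum_(v < n) (map_vec s v == u) = #|[set v | assignment s v == Ordinal un]|.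
    rewrite -sum1dep_card [RHS]big_mkcond /=; apply: eq_bigr => v _.
    by rewrite map_vecE -val_eqE /=; case: (_ == _).
  by case: (constraint _) => //= h; rewrite ?h // (negbTE h).
- move=> v vn; rewrite (map_vecE s (Ordinal vn)) (node_distE _ (Ordinal vn)).
  apply: Order.POrderTheory.le_trans hR.
  rewrite /objective; exact: (Order.TotalTheory.le_bigmax _ (fun v => dist (assignment s v) v)).
Qed.

(** A maximum over a nonempty set is attained; this is why trying all pairs of nodes includes the
    optimal radius. *)
Lemma objective_attained (s : solution I) : 0 < n -> exists i j : 'I_n, objective s = dist i j.
Proof.
move=> n0.
have [i _ E] := @Order.TotalTheory.eq_bigmax _ _ _ 0%R (Ordinal n0) xpredT
  (fun v => dist (assignment s v) v) isT (fun v _ => let: And4 h _ _ _ := dist_metric I in h _ _).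
by exists (assignment s i), i.
Qed.

Lemma valid_feasible (S sg : nat -> nat) R : ok R S sg -> (0 <= R)%R ->
  exists s : solution I, [/\ feasible s, (objective s <= R)%R
    & encode_solution s = mkseq S n ++ mkseq sg n].
Proof.
case=> v1 v2 v3 v4 v5 R0.
pose s := @Solution I [set u : 'I_n | S u != 0] (fun v => insubd v (sg v)).
have sgE (v : 'I_n) : nat_of_ord (assignment s v) = sg v.
  by rewrite /= val_insubd; case: (v3 v (ltn_ord v)) => ->.
exists s; split.
- split.
  + apply: leq_trans v1; rewrite -sum1_card [X in X <= _]big_mkcond /=.
    by apply: leq_sum => u _; rewrite inE; case: (S u).
  + by move=> v; rewrite inE sgE; case: (v3 v (ltn_ord v)).
  + move=> u; rewrite inE => hu.
    have E : \sum_(v < n) (sg v == u) = #|[set v | assignment s v == u]|.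
      rewrite -sum1dep_card [RHS]big_mkcond /=; apply: eq_bigr => v _.
      by rewrite -[_ == u in RHS]val_eqE -[val (insubd _ _)]/(nat_of_ord (assignment s v)) sgE; case: (_ == _).
    have := v4 u (ltn_ord u) hu; rewrite node_typeE E.
    by case: (constraint u) => //= h; rewrite h.
- apply: Order.POrderTheory.bigmax_le => // v _.
  by rewrite -node_distE sgE v5.
- congr (_ ++ _).
    apply: (@eq_from_nth _ 0); rewrite size_map size_enum_ord ?size_mkseq // => i hi.
    rewrite nth_mkseq // (nth_enum_ord_map 0 _ (Ordinal hi)) inE /=.
    by have := v2 i hi; case: (S i) => [|[|]].
  apply: (@eq_from_nth _ 0); rewrite size_map size_enum_ord ?size_mkseq // => i hi.
  by rewrite nth_mkseq // (nth_enum_ord_map 0 _ (Ordinal hi)) sgE.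
Qed.

Lemma main_valid (out := inp (lrun n (size xs) main_cmd (linit xs))) :
  0 < n -> (exists s : solution I, feasible s) ->
  exists u v, [/\ u < n, v < n, ok (7%:R * node_dist u v)%R out (fun w => out (n + w))
    & forall s : solution I, feasible s -> (node_dist u v <= objective s)%R].
Proof.
move=> n0 [s0 f0]; rewrite {}/out.
have [d_ge0 d_eq0 d_sym d_tri] := dist_metric I.
have dE u v (un : u < n) (vn : v < n) : node_dist u v = dist (Ordinal un) (Ordinal vn).
  exact: (node_distE (Ordinal un) (Ordinal vn)).
have [|||||||||||u [v [h1 h2 h3 h4]]] := @main_spec n (size xs) (max_centers I) (nth 0 xs)
   node_type node_dist _ _ _ _ _ _ _ _ _ (linit xs) _ erefl erefl.
- by rewrite nth_minn.
- by move=> v vn; rewrite nth_minn (nth_type (Ordinal vn)).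
- move=> u v un vn; rewrite nth_minn dE -[X in nth _ _ X]addn0.
  by rewrite (nth_dist (Ordinal un) (Ordinal vn)).
- move=> u v un vn; rewrite nth_minn dE.
  have -> : 3 + n + 2 * (u * n + v) = 2 + n + 2 * (u * n + v) + 1 by lia.
  by rewrite (nth_dist (Ordinal un) (Ordinal vn)).
- by move=> u v un vn; rewrite dE.
- by move=> u un; rewrite dE; apply/d_eq0/val_inj.
- by move=> u v un vn; rewrite !dE.
- by move=> u v w un vn wn; rewrite !dE.
- by move=> v vn; rewrite (node_typeE (Ordinal vn)); case: (constraint _).
- by rewrite size_encode; nia.
- have [i [j E]] := objective_attained s0 n0.
  exists i, j, (set_vec s0), (map_vec s0); split=> //.
  by apply: feasible_valid => //; rewrite node_distE E.
exists u, v; split=> // s fs; have [i [j E]] := objective_attained s n0.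
rewrite E -node_distE; apply: (h4 i j (set_vec s) (map_vec s)) => //.
by apply: feasible_valid => //; rewrite node_distE E.
Qed.

End Instance.

Theorem theorem3 :
  exists (alpha : rat) (P : prog), approximation_algorithm alpha P.
Proof.
exists 7%:R%R, (driver main_cmd); split.
  have [p hp] := polynomial_dtime main_cmd; exists p => I.
  have NB : num_nodes I + num_nodes I <= size (encode_instance I).
    by rewrite size_encode; nia.
  have [T h1 h2] := driver_runs (xs := encode_instance I) wfc_main NB.
  by eexists T, _; split; [exact: h1 | rewrite -hp].
move=> I fe.
have NB : num_nodes I + num_nodes I <= size (encode_instance I).
  by rewrite size_encode; nia.
have [T] := driver_runs (xs := encode_instance I) wfc_main NB.
rewrite [nth 0 _ 0]/=; set out := inp _; move=> R _; exists T.
have objective_ge0 (s : solution I) : (0 <= objective s)%R.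
  exact: Order.TotalTheory.bigmax_ge_id.
(* Without nodes there is no radius to guess: the output is empty and encodes any solution, and the
   objective is the default 0. *)
case: (posnP (num_nodes I)) => [n0|n0].
  case: fe => s fs; exists s; split=> //.
    have enum0 (f : 'I_(num_nodes I) -> nat) : [seq f v | v <- enum 'I_(num_nodes I)] = [::].
      by apply: size0nil; rewrite size_map size_enum_ord.
    have out0 : mkseq out (num_nodes I + num_nodes I) = [::].
      by apply: size0nil; rewrite size_mkseq n0.
    by rewrite out0 in R; rewrite /encode_solution !enum0.
  move=> opt [[s' _ <-] _].
  apply: (Order.POrderTheory.le_trans (_ : (_ <= 0)%R)).
    by apply: Order.POrderTheory.bigmax_le => // v; have := ltn_ord v; rewrite {2}n0.
  by rewrite Num.Theory.mulr_ge0.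
have [u [v [un vn V opt_ge]]] := main_valid n0 fe.
have d0 : (0 <= node_dist I u v)%R.
  rewrite (node_distE (Ordinal un) (Ordinal vn)).
  by case: (dist_metric I).
have [|s [fs os es]] := valid_feasible V; first by rewrite Num.Theory.mulr_ge0.
exists s; split=> //.
  rewrite es -/out (_ : _ ++ _ = mkseq out (num_nodes I + num_nodes I)) //.
  rewrite /mkseq iotaD map_cat add0n; congr (_ ++ _).
  have -> : iota (num_nodes I) (num_nodes I) =
      [seq num_nodes I + i | i <- iota 0 (num_nodes I)] by rewrite -iotaDl addn0.
  by rewrite -map_comp.
move=> opt [[s' fs' <-] _]; apply: (Order.POrderTheory.le_trans os).
by rewrite Num.Theory.ler_wpM2l // opt_ge.
Qed.
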